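(* Let $X$ be a real random variable with $\mathbb{E}|X|<+\infty$. Let $b\in\mathbb{R}$ and let $\nu$ be a positive Borel measure on $\mathbb{R}$ such that $\nu(\{0\})=0$, $\int_{-\infty}^{+\infty}(1\wedge u^2)\,\nu(du)<+\infty$ and $\int_{|u|>1}|u|\,\nu(du)<+\infty$. Then $$\mathbb{E}\left(Xf(X)-bf(X)-\int_{-\infty}^{+\infty}\big(f(X+u)-f(X)\mathbf{1}_{|u|\le 1}\big)\,u\,\nu(du)\right)=0$$ for all bounded Lipschitz functions $f:\mathbb{R}\to\mathbb{R}$ if and only if $X\sim ID(b,0,\nu)$.
   Context: For $b\in\mathbb{R}$ and a positive Borel measure $\nu$ on $\mathbb{R}$ with $\nu(\{0\})=0$ and $\int(1\wedge u^2)\nu(du)<\infty$, $X\sim ID(b,0,\nu)$ means that $X$ is infinitely divisible without Gaussian component with characteristic function $\mathbb{E}e^{itX}=\exp\big(itb+\int_{-\infty}^{+\infty}(e^{itu}-1-itu\mathbf{1}_{|u|\le1})\nu(du)\big)$, $t\in\mathbb{R}$. *)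

(* Defs.v *)
From HB Require Import structures.
From mathcomp Require Import all_boot all_order all_algebra.
From mathcomp Require Import all_classical all_reals all_analysis.
From mathcomp Require Import measurable_realfun complex.

Set Implicit Arguments.
Unset Strict Implicit.
Unset Printing Implicit Defensive.

Import Order.TTheory GRing.Theory Num.Theory.
Import numFieldNormedType.Exports.

Local Open Scope classical_set_scope.
Local Open Scope ring_scope.
Local Open Scope complex_scope.

Section complex_valued.
Context {R : realType}.

Definition cexp (z : R[i]) : R[i] :=
  (expR (complex.Re z))%:C
  * (cos (complex.Im z) +i* sin (complex.Im z)).

(* The real and imaginary parts are [Rintegral]s, so this is meaningful only
   when both are integrable. *)
Definition Cintegral d (T : measurableType d) (mu : {measure set T -> \bar R})
    (f : T -> R[i]) : R[i] :=
  Rintegral mu setT (fun x => complex.Re (f x))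
  +i* Rintegral mu setT (fun x => complex.Im (f x)).

Definition char_fun d (T : measurableType d) (P : probability T R)
    (X : {RV P >-> measurableTypeR R}) (t : R) : R[i] :=
  Cintegral P (fun w => cexp ('i * (t * X w)%:C)).

End complex_valued.

Section infinite_divisibility.
Context {R : realType}.

Definition add_pair (z : measurableTypeR R * measurableTypeR R) :
  measurableTypeR R := z.1 + z.2.

Lemma measurable_add_pair : measurable_fun setT add_pair.
Proof. apply: measurable_funD; [exact: measurable_fst|exact: measurable_snd]. Qed.

HB.instance Definition _ :=
  isMeasurableFun.Build _ _ _ _ add_pair measurable_add_pair.

Definition convolution (mu nu : probability (measurableTypeR R) R) :
    probability (measurableTypeR R) R :=
  distribution (mu \x nu)%E add_pair.

Definition convolution_power (mu : probability (measurableTypeR R) R) (n : nat) :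
    probability (measurableTypeR R) R :=
  iter n (convolution mu) \d_(0 : measurableTypeR R).

Definition infinitely_divisible (mu : probability (measurableTypeR R) R) : Prop :=
  forall n : nat, (0 < n)%N ->
  exists rho : probability (measurableTypeR R) R,
  forall A : set (measurableTypeR R), measurable A ->
    mu A = convolution_power rho n A.

(* Truncation function 1_{|u| <= 1}; no Gaussian component means that there is
   no term - sigma^2 t^2 / 2. *)
Definition levy_exponent (b : R) (nu : {measure set (measurableTypeR R) -> \bar R})
    (t : R) : R[i] :=
  'i * (t * b)%:C
  + Cintegral nu (fun u : R =>
      cexp ('i * (t * u)%:C) - 1 - 'i * (t * u * (`|u| <= 1)%R%:R)%:C).

Definition has_law_ID d (T : measurableType d) (P : probability T R)
    (X : {RV P >-> measurableTypeR R}) (b : R)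
    (nu : {measure set (measurableTypeR R) -> \bar R}) : Prop :=
  infinitely_divisible (distribution P X) /\
  forall t : R, char_fun X t = cexp (levy_exponent b nu t).

End infinite_divisibility.

(* Main.v *)
(* Let phi be the characteristic function of X and psi the Levy exponent.  On the
   functions cos (t x + s), the identity is equivalent to phi' = psi' phi: the
   addition formulas turn the jump integral into a combination of the derivatives of
   the real and imaginary parts of psi.  Together with phi(0) = 1 this means
   phi = exp psi.

   For the converse it remains to pass from trigonometric polynomials to a bounded
   Lipschitz f.  Writing k sin (x / k) for x and taking Bernstein polynomials gives
   trigonometric polynomials that converge pointwise to f with the bound and the
   Lipschitz constant of f, and dominated convergence applies.  The same approximation
   shows that a probability measure is determined by its characteristic function.

   Infinite divisibility requires a law with characteristic function exp (psi / n).
   It is obtained as a limit of convolution powers of mixtures of a point mass at 0 and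
   of nu restricted to |u| > 1/(k+1); the n-th convolution power of the limit is then
   the law of X by uniqueness. *)

From HB Require Import structures.
Require Import Defs.
From mathcomp Require Import all_boot all_order all_algebra.
From mathcomp Require Import all_classical all_reals all_analysis.
From mathcomp Require Import measurable_realfun complex ring lra.

Set Implicit Arguments.
Unset Strict Implicit.
Unset Printing Implicit Defensive.

Import Order.TTheory GRing.Theory Num.Theory.
Import numFieldNormedType.Exports.

Local Open Scope classical_set_scope.
Local Open Scope ring_scope.

(** The jump integrand is controlled near 0 by the Lipschitz constant of the test function and away
    from 0 by its bound. An approximation therefore has to keep both constants; closeness on compact
    sets alone would not dominate the integral. The moment hypotheses enter through derivatives:
    integrability of |X| makes phi differentiable, and the first moment of nu away from 0 serves the
    same purpose for psi. The equation is then solved by multiplying by exp (- psi), so no logarithm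
    of phi is taken and phi need not be known to avoid 0. Since the test functions are real, phi and
    psi are handled as pairs of real functions, and the phases s = 0 and s = - pi / 2 carry the two
    real components of the equation. For existence, powers (1 + w)^m take the place of compound
    Poisson laws: they come from convolution powers of mixtures and need no exponential series. The
    limit law is built from distribution functions; as the limits of the integrals of cosines and
    sines are known beforehand, a limit along a single ultrafilter suffices. *)

Section elementary_bounds.
Context {R : realType}.
Implicit Types x y t c : R.

Lemma norm_sub_le_derive (f df : R -> R) (K : R) :
  (forall x, is_derive x 1 f (df x)) -> (forall x, `|df x| <= K) ->
  forall x y, `|f x - f y| <= K * `|x - y|.
Proof.
move=> fdf dfK x y.
wlog xy : x y / x <= y.
  by move=> H; case/orP: (le_total x y) => /H //; rewrite distrC [X in _ <= _ * X]distrC.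
have [z _ yx] : exists2 z, z \in `[x, y]%R & f y - f x = df z * (y - x).
  apply: MVT_segment => // z.
  apply: continuous_subspaceT => {}z; apply: differentiable_continuous.
  by apply/derivable1_diffP; apply: ex_derive.
by rewrite distrC yx normrM [`|x - y|]distrC ler_wpM2r.
Qed.

Lemma norm_cosB x y : `|cos x - cos y| <= `|x - y|.
Proof.
rewrite -[leRHS]mul1r; apply: (@norm_sub_le_derive _ (fun z => - sin z)) => z.
by rewrite normrN sin_max.
Qed.

Lemma norm_sinB x y : `|sin x - sin y| <= `|x - y|.
Proof.
rewrite -[leRHS]mul1r; apply: (@norm_sub_le_derive _ cos) => z; exact: cos_max.
Qed.

Lemma norm_sin_le x : `|sin x| <= `|x|.
Proof. by have := norm_sinB x 0; rewrite sin0 !subr0. Qed.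

Lemma norm_cosB1_le x : `|cos x - 1| <= `|x|.
Proof. by have := norm_cosB x 0; rewrite cos0 !subr0. Qed.

(** Taylor bounds follow from it one order at a time: the remainder estimate vanishes at 0 and its
    derivative is the estimate of lower order. *)
Lemma ge0_of_derive_ge0 (f df : R -> R) :
  (forall x, is_derive x 1 f (df x)) -> (forall x, 0 <= x -> 0 <= df x) ->
  f 0 = 0 -> forall x, 0 <= x -> 0 <= f x.
Proof.
move=> fdf df0 f0 x x0.
have [z zx yx] : exists2 z, z \in `[0, x]%R & f x - f 0 = df z * (x - 0).
  apply: MVT_segment => // z.
  apply: continuous_subspaceT => {}z; apply: differentiable_continuous.
  by apply/derivable1_diffP; apply: ex_derive.
move: yx; rewrite f0 !subr0 => ->; rewrite mulr_ge0// df0//.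
by move: zx; rewrite in_itv/= => /andP[].
Qed.

Lemma cosB1_le_sqr x : `|cos x - 1| <= x ^+ 2 / 2.
Proof.
rewrite ler0_norm ?subr_le0 ?cos_le1// opprB.
wlog x0 : x / 0 <= x.
  by move=> H; case/orP: (le_total 0 x) => [/H//|]; rewrite -oppr_ge0 => /H; rewrite cosN sqrrN.
rewrite -subr_ge0.
apply: (@ge0_of_derive_ge0 (fun x => x ^+ 2 / 2 - (1 - cos x)) (fun x => x - sin x)) => //.
- move=> z; apply: is_derive_eq; rewrite /GRing.scale/=; lra.
- move=> z z0; rewrite subr_ge0 (le_trans (ler_norm _))// (le_trans (norm_sin_le _))//.
  by rewrite ger0_norm.
- by rewrite cos0 expr0n/=; lra.
Qed.

Lemma sinB_le_sqr x : `|sin x - x| <= x ^+ 2 / 2.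
Proof.
wlog x0 : x / 0 <= x.
  move=> H; case/orP: (le_total 0 x) => [/H//|]; rewrite -oppr_ge0 => /H.
  by rewrite sinN sqrrN -opprD normrN.
rewrite ler0_norm; last first.
  rewrite subr_le0 (le_trans (ler_norm _))// (le_trans (norm_sin_le _))//.
  by rewrite ger0_norm.
rewrite -subr_ge0.
apply: (@ge0_of_derive_ge0 (fun x => x ^+ 2 / 2 - - (sin x - x)) (fun x => x + cos x - 1)) => //.
- move=> z; apply: is_derive_eq; rewrite /GRing.scale/=; lra.
- move=> z z0; have := norm_cosB1_le z; rewrite (ger0_norm z0) ler_norml => /andP[]; lra.
- by rewrite sin0 expr0n/=; lra.
Qed.

End elementary_bounds.

(** * Trigonometric approximation of bounded Lipschitz functions *)

Section trigonometric_approximation.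
Context {R : realType}.
Implicit Types (f : R -> R) (c : nat -> R).

(** The free phase [s] lets one constructor produce constants ([t = 0]), cosines and sines
    ([s = - pi / 2]). *)
Inductive trig : (R -> R) -> Prop :=
| trig_cos (a t s : R) : trig (fun x => a * cos (t * x + s))
| trigD f g : trig f -> trig g -> trig (fun x => f x + g x).

Lemma trigM_cos f (a t s : R) : trig f -> trig (fun x => f x * (a * cos (t * x + s))).
Proof.
elim=> {f} [a' t' s'|f g _ IHf _ IHg].
  have -> : (fun x => a' * cos (t' * x + s') * (a * cos (t * x + s))) =
     (fun x => (a' * a / 2) * cos ((t' + t) * x + (s' + s)) +
               (a' * a / 2) * cos ((t' - t) * x + (s' - s))).
    apply/funext => x.
    have -> : (t' + t) * x + (s' + s) = (t' * x + s') + (t * x + s) by ring.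
    have -> : (t' - t) * x + (s' - s) = (t' * x + s') - (t * x + s) by ring.
    rewrite cosB (cosD (t' * x + s')); by field.
  by apply: trigD; exact: trig_cos.
have -> : (fun x => (f x + g x) * (a * cos (t * x + s))) =
     (fun x => f x * (a * cos (t * x + s)) + g x * (a * cos (t * x + s))).
  by apply/funext => x; rewrite mulrDl.
exact: trigD.
Qed.

(** The Bernstein polynomial of degree [n] with coefficients [c], in de Casteljau form. Each step is
    a convex combination when [y] is in [0, 1], so bounds go by induction without binomial
    coefficients. *)
Fixpoint casteljau n c (y : R) : R :=
  if n is n'.+1 then (1 - y) * casteljau n' c y + y * casteljau n' (fun j => c j.+1) y
  else c 0%N.

Lemma casteljau_lin n (a b : R) c c' (y : R) :
  casteljau n (fun j => a * c j + b * c' j) y = a * casteljau n c y + b * casteljau n c' y.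
Proof. by elim: n c c' => [//|n IH] c c' /=; rewrite !IH; ring. Qed.

Lemma casteljau_cst n (a y : R) : casteljau n (fun=> a) y = a.
Proof. by elim: n => [//|n /= ->]; ring. Qed.

Lemma le_casteljau n c c' (y : R) : 0 <= y <= 1 -> (forall j, (j <= n)%N -> c j <= c' j) ->
  casteljau n c y <= casteljau n c' y.
Proof.
move=> /andP[y0 y1]; elim: n c c' => [c c' /(_ 0%N)->//|n IH] c c' cc' /=.
by rewrite lerD// ler_wpM2l ?subr_ge0// IH// => j jn; rewrite cc'// ltnW.
Qed.

Lemma norm_casteljau n c (y M : R) : 0 <= y <= 1 -> (forall j, (j <= n)%N -> `|c j| <= M) ->
  `|casteljau n c y| <= M.
Proof.
move=> y01 cM; rewrite ler_norml; apply/andP; split.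
  rewrite -[leLHS](casteljau_cst n _ y); apply: le_casteljau => // j jn.
  by have := cM _ jn; rewrite ler_norml => /andP[].
rewrite -[leRHS](casteljau_cst n _ y); apply: le_casteljau => // j jn.
by have := cM _ jn; rewrite ler_norml => /andP[].
Qed.

(** The derivative of a Bernstein polynomial is [n] times the one of the increments of [c]. In the
    induction each degree contributes one such polynomial, multiplied by [x - y]. *)
Lemma casteljau_lipschitz n c (D x y : R) : 0 <= x <= 1 -> 0 <= y <= 1 ->
  (forall j, (j < n)%N -> `|c j.+1 - c j| <= D) ->
  `|casteljau n c x - casteljau n c y| <= n%:R * D * `|x - y|.
Proof.
move=> x01 y01; elim: n c => [c _|n IH c cD] /=; first by rewrite subrr normr0 mul0r mul0r.
set A := casteljau n c; set B := casteljau n _.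
have -> : (1 - x) * A x + x * B x - ((1 - y) * A y + y * B y) =
  (1 - x) * (A x - A y) + x * (B x - B y) + (x - y) * (B y - A y) by ring.
have HA : `|A x - A y| <= n%:R * D * `|x - y| by apply: IH => j jn; apply: cD; exact: ltnW.
have HB : `|B x - B y| <= n%:R * D * `|x - y| by apply: IH => j jn; apply: cD.
have HBA : `|B y - A y| <= D.
  have -> : B y - A y = casteljau n (fun j => 1 * c j.+1 + (-1) * c j) y.
    by rewrite (casteljau_lin n 1 (-1) (fun j => c j.+1) c) /A /B; ring.
  by apply: norm_casteljau => // j jn; rewrite mul1r mulN1r; exact: cD.
have /andP[x0 x1] := x01.
apply: (le_trans (ler_normD _ _)); apply: (le_trans (lerD (ler_normD _ _) (lexx _))).
rewrite !normrM (ger0_norm x0) (@ger0_norm _ (1 - x)) ?subr_ge0//.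
have -> : n.+1%:R * D * `|x - y| = (1 - x) * (n%:R * D * `|x - y|) + x * (n%:R * D * `|x - y|)
   + `|x - y| * D by rewrite -natr1; ring.
by rewrite lerD// ?lerD// ler_wpM2l// subr_ge0.
Qed.

(** The second moment of a shifted binomial law: squared mean plus variance. The shift [a] is kept
    free because the recursion replaces [j] by [j + 1]. *)
Lemma casteljau_sqr n (a y : R) :
  casteljau n (fun j => (j%:R + a) ^+ 2) y = (n%:R * y + a) ^+ 2 + n%:R * (y * (1 - y)).
Proof.
elim: n a => [|n IH] a /=; first by rewrite mul0r mul0r addr0.
rewrite IH; have -> : (fun j => (j.+1%:R + a) ^+ 2) = (fun j => (j%:R + (a + 1)) ^+ 2).
  by apply/funext => j; rewrite -natr1; ring.
by rewrite IH -natr1; ring.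
Qed.

Lemma trig_casteljau n c (t : R) : trig (fun x => casteljau n c ((1 + sin (t * x)) / 2)).
Proof.
elim: n c => [c|n IH c] /=.
  have -> : (fun=> c 0%N) = (fun x => c 0%N * cos (0 * x + 0)).
    by apply/funext => x; rewrite mul0r addr0 cos0 mulr1.
  exact: trig_cos.
set A := fun x => casteljau n c ((1 + sin (t * x)) / 2).
set B := fun x => casteljau n (fun j => c j.+1) ((1 + sin (t * x)) / 2).
have -> : (fun x => (1 - (1 + sin (t * x)) / 2) * casteljau n c ((1 + sin (t * x)) / 2) +
   (1 + sin (t * x)) / 2 * casteljau n (fun j => c j.+1) ((1 + sin (t * x)) / 2)) =
  (fun x => (A x * (2^-1 * cos (0 * x + 0)) + A x * (- 2^-1 * cos (t * x + - (pi / 2)))) +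
    (B x * (2^-1 * cos (0 * x + 0)) + B x * (2^-1 * cos (t * x + - (pi / 2))))).
  by apply/funext => x; rewrite cosBpihalf mul0r addr0 cos0 /A /B; by field.
by apply: trigD; apply: trigD; apply: trigM_cos; exact: IH.
Qed.

Definition bdd_lip (M L : R) f := (forall x, `|f x| <= M) /\ (forall x y, `|f x - f y| <= L * `|x - y|).

(* Composing the Bernstein polynomials of [y |-> f (k y)] with [sin (x / k)]
   keeps the bound and the Lipschitz constant of [f]. *)
Lemma trig_approx f (M L : R) : bdd_lip M L f ->
  exists f_ : nat -> R -> R, [/\ forall n, trig (f_ n), forall n, bdd_lip M L (f_ n) &
    forall x, f_ ^~ x @ \oo --> f x].
Proof.
move=> [fM fL].
have L0 : 0 <= L by have := fL 1 0; rewrite subr0 normr1 mulr1; apply: le_trans.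
pose k n : R := n.+1%:R.
have k0 n : 0 < k n by rewrite ltr0n.
(* The nodes, spread over [- k, k], have under the binomial law a standard deviation of order k /
   sqrt N; degree k ^ 4 makes it of order 1 / k. *)
pose N n := (n.+1 ^ 4)%N.
have Nk n : (N n)%:R = k n ^+ 4 by rewrite natrX.
pose c n j := f (k n * (2 * (j%:R / (N n)%:R) - 1)).
pose y n x := (1 + sin ((k n)^-1 * x)) / 2.
have y01 n x : 0 <= y n x <= 1.
  have := sin_geN1 ((k n)^-1 * x); have := sin_le1 ((k n)^-1 * x); rewrite /y; lra.
exists (fun n x => casteljau (N n) (c n) (y n x)).
have LN n : 0 < (N n)%:R :> R by rewrite Nk exprn_gt0.
split.
- by move=> n; exact: trig_casteljau.
- move=> n; split=> [x|u v]; first by apply: norm_casteljau => // j _; exact: fM.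
  (* Neighbouring nodes are 2 k / N apart, so the polynomial has Lipschitz constant 2 L k in [y];
     the constant 1 / (2 k) of [y n] reduces it to exactly [L]. *)
  apply: (le_trans (@casteljau_lipschitz _ _ (2 * L * k n / (N n)%:R) _ _ (y01 n u) (y01 n v) _)).
    move=> j _; apply: (le_trans (fL _ _)).
    rewrite (_ : _ - _ = 2 * k n / (N n)%:R); last by rewrite -natr1; field; rewrite gt_eqF.
    rewrite ger0_norm; last by rewrite divr_ge0// ?mulr_ge0// ltW.
    by rewrite le_eqVlt; apply/orP; left; apply/eqP; ring.
  have -> : (N n)%:R * (2 * L * k n / (N n)%:R) = 2 * L * k n by field; rewrite gt_eqF.
  have -> : y n u - y n v = (sin ((k n)^-1 * u) - sin ((k n)^-1 * v)) / 2 by rewrite /y; field.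
  have -> : L * `|u - v| = 2 * L * k n * (`|(k n)^-1 * u - (k n)^-1 * v| / 2).
    by rewrite -mulrBr normrM gtr0_norm ?invr_gt0//; field; rewrite gt_eqF.
  rewrite normrM [`|2^-1|]ger0_norm//; apply: ler_wpM2l; first by rewrite !mulr_ge0// ltW.
  by rewrite ler_wpM2r// norm_sinB.
- move=> x.
  have H n : `|f x - casteljau (N n) (c n) (y n x)| <= (L * (5 + x ^+ 2) / 2) * (k n)^-1.
    set u := y n x; have u01 : 0 <= u <= 1 by exact: y01.
    pose g := f (k n * (2 * u - 1)).
    have H1 : `|f x - g| <= (L * x ^+ 2 / 2) * (k n)^-1.
      apply: (le_trans (fL _ _)).
      have -> : x - k n * (2 * u - 1) = - (k n * (sin ((k n)^-1 * x) - (k n)^-1 * x)).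
        by rewrite /u /y; field; rewrite gt_eqF.
      rewrite normrN normrM gtr0_norm// -!mulrA ler_wpM2l//.
      apply: (le_trans (ler_wpM2l (ltW (k0 n)) (sinB_le_sqr _))).
      by rewrite exprMn le_eqVlt; apply/orP; left; apply/eqP; field; rewrite gt_eqF.
    have H2 : `|g - casteljau (N n) (c n) u| <= (L * 5 / 2) * (k n)^-1.
      have -> : g - casteljau (N n) (c n) u =
          casteljau (N n) (fun j => 1 * g + (-1) * c n j) u.
        by rewrite (casteljau_lin (N n) 1 (-1) (fun=> g) (c n)) casteljau_cst; ring.
      (* Second moments are what [casteljau_sqr] computes, so the deviation of a node is bounded by
         a quadratic, by completing the square below. The weights 1 / k and k ^ 3 are balanced so
         that both terms contribute order 1 / k. *)
      pose d j := 2 * L / k n + 2 * L * k n ^+ 3 / (N n)%:R ^+ 2 * (j%:R + (- ((N n)%:R * u))) ^+ 2.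
      have gd j : `|1 * g + (-1) * c n j| <= d j.
        rewrite mul1r mulN1r /g /c; apply: (le_trans (fL _ _)).
        pose z := (j%:R - (N n)%:R * u) / (N n)%:R.
        have -> : k n * (2 * u - 1) - k n * (2 * (j%:R / (N n)%:R) - 1) = - (2 * k n * z).
          by rewrite /z; field; rewrite gt_eqF.
        have -> : d j = L * (2 * (k n)^-1 + 2 * k n ^+ 3 * z ^+ 2).
          by rewrite /d /z; field; rewrite !gt_eqF.
        rewrite ler_wpM2l// normrN normrM (@ger0_norm _ (2 * k n)); last by rewrite mulr_ge0// ltW.
        have -> : z ^+ 2 = `|z| ^+ 2 by rewrite real_normK// num_real.
        set w := `|z|; have w0 : 0 <= w by exact: normr_ge0.
        rewrite -subr_ge0.
        have -> : 2 * (k n)^-1 + 2 * k n ^+ 3 * w ^+ 2 - 2 * k n * w =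
           (k n)^-1 * (2 * (k n ^+ 2 * w - 1/2) ^+ 2 + 3 / 2).
          by field; rewrite gt_eqF.
        apply: mulr_ge0; first by rewrite invr_ge0 ltW.
        by rewrite addr_ge0// mulr_ge0// sqr_ge0.
      apply: (@le_trans _ _ (casteljau (N n) d u)).
        rewrite ler_norml; apply/andP; split; last first.
          by apply: le_casteljau => // j _; rewrite (le_trans (ler_norm _)).
        rewrite lerNl -[leLHS]mulN1r -[X in X <= _]addr0 -[X in _ + X <= _](mul0r (casteljau (N n) d u)).
        rewrite -casteljau_lin; apply: le_casteljau => // j _.
        by have := gd j; rewrite ler_norml => /andP[]; lra.
      pose e1 : nat -> R := fun=> 2 * L / k n.
      pose e2 : nat -> R := fun j => (j%:R + (- ((N n)%:R * u))) ^+ 2.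
      have -> : d = (fun j => 1 * e1 j + (2 * L * k n ^+ 3 / (N n)%:R ^+ 2) * e2 j).
        by apply/funext => j; rewrite mul1r.
      rewrite casteljau_lin casteljau_cst casteljau_sqr subrr expr0n/= add0r mul1r.
      have /andP[u0 u1] := y01 n x.
      have -> : 2 * L / k n + 2 * L * k n ^+ 3 / (N n)%:R ^+ 2 * ((N n)%:R * (u * (1 - u))) =
         L * (2 + 2 * (u * (1 - u))) * (k n)^-1.
        by rewrite Nk; field; rewrite gt_eqF.
      have -> : L * 5 / 2 / k n = L * (5 / 2) * (k n)^-1 by rewrite -!mulrA.
      apply: ler_wpM2r; first by rewrite invr_ge0 ltW.
      apply: ler_wpM2l => //.
      (* The variance factor [u * (1 - u)] is at most 1/4, whence the constant 5/2. *)
      have : 0 <= (u - 1/2)^+2 by exact: sqr_ge0.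
      have -> : (u - 1/2)^+2 = 1/4 - u * (1 - u) by field.
      by lra.
    have -> : f x - casteljau (N n) (c n) u = (f x - g) + (g - casteljau (N n) (c n) u) by ring.
    apply: (le_trans (ler_normD _ _)); apply: (le_trans (lerD H1 H2)).
    by rewrite le_eqVlt; apply/orP; left; apply/eqP; ring.
  apply/cvgrPdist_le => e e0.
  have : (L * (5 + x ^+ 2) / 2) * (k n)^-1 @[n --> \oo] --> (L * (5 + x ^+ 2) / 2) * 0.
    by apply: cvgMr; exact: cvg_harmonic.
  rewrite mulr0 => /cvgrPdist_le/(_ _ e0); apply: filterS => n.
  rewrite sub0r normrN; apply: le_trans; rewrite (le_trans (H n))//.
  exact: ler_norm.
Qed.

End trigonometric_approximation.

(** * Integrability and dominated convergence for real-valued integrals *)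

Section integration_preliminaries.
Context {R : realType} d (T : measurableType d).

Lemma integrable_le (mu : {measure set T -> \bar R}) (f g : T -> R) :
  measurable_fun setT f -> mu.-integrable setT (EFin \o g) ->
  (forall x, `|f x| <= g x) -> mu.-integrable setT (EFin \o f).
Proof.
move=> mf ig fg; apply: (le_integrable measurableT _ _ ig).
  exact/measurable_EFinP.
by move=> x _ /=; rewrite lee_fin (le_trans (fg x))// ler_norm.
Qed.

Lemma integrable_bounded (P : probability T R) (f : T -> R) (M : R) :
  measurable_fun setT f -> (forall x, `|f x| <= M) -> P.-integrable setT (EFin \o f).
Proof.
move=> mf fM; apply: (@integrable_le _ _ (cst M)) => //.
by apply: finite_measure_integrable_cst.
Qed.

Lemma Rintegral_dominated_cvg (mu : {measure set T -> \bar R}) (f_ : nat -> T -> R) (f g : T -> R) :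
  (forall n, measurable_fun setT (f_ n)) -> mu.-integrable setT (EFin \o g) ->
  (forall n x, `|f_ n x| <= g x) -> (forall x, f_ ^~ x @ \oo --> f x) ->
  Rintegral mu setT (f_ n) @[n --> \oo] --> Rintegral mu setT f.
Proof.
move=> mf ig fg ff.
have mlim : measurable_fun setT f.
  by apply: (measurable_fun_cvg (h := f_)) => // x _; exact: ff.
have ilim : mu.-integrable setT (EFin \o f).
  apply: (integrable_le mlim ig) => x.
  apply: (@closed_cvg _ _ \oo _ (fun n => `|f_ n x|) (fun y => y <= g x)).
  - exact: closed_le.
  - exact: nearW.
  - by apply: cvg_norm; exact: ff.
rewrite /Rintegral; apply: fine_cvg; rewrite fineK; last exact: integrable_fin_num.
have [|||||_ _] := @dominated_convergence _ _ _ mu setT measurableT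
  (fun n => EFin \o f_ n) (EFin \o f) (EFin \o g); last exact.
- by move=> n; exact/measurable_EFinP.
- exact/measurable_EFinP.
- by apply: aeW => x _ /=; apply: cvg_EFin; [exact: nearW|exact: ff].
- exact: ig.
- by apply: aeW => x n _ /=; rewrite lee_fin.
Qed.

End integration_preliminaries.

(** * Regularity of bounded Lipschitz functions, and ramps *)

Section bounded_lipschitz.
Context {R : realType}.
Implicit Types f g : R -> R.

Lemma bdd_lip_continuous M L f : bdd_lip M L f -> continuous f.
Proof.
move=> [_ fL] x; apply/cvgrPdist_lt => e e0.
have L0 : 0 <= L by have := fL 1 0; rewrite subr0 normr1 mulr1; apply: le_trans.
have d0 : 0 < e / (L + 1) by rewrite divr_gt0// ltr_wpDl.
near=> y.
apply: (le_lt_trans (fL _ _)).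
have : `|x - y| < e / (L + 1) by near: y; exact: cvgr_dist_lt.
rewrite ltr_pdivlMr ?ltr_wpDl//; apply: le_lt_trans.
by rewrite mulrC ler_wpM2l// lerDl.
Unshelve. all: by end_near. Qed.

Lemma bdd_lip_measurable M L f : bdd_lip M L f ->
  measurable_fun setT (f : measurableTypeR R -> R).
Proof. by move=> /bdd_lip_continuous cf; exact: continuous_measurable_fun. Qed.

(** The ramps [clamp (k * (x - a))] vanish up to [a] and tend to 1 beyond it, so they approximate
    the indicator of the open half-line []a, +oo[]. *)
Definition clamp (x : R) : R := Num.max 0 (Num.min 1 x).

Lemma clamp_bdd_lip (k a : R) : 0 <= k -> bdd_lip 1 k (fun x => clamp (k * (x - a))).
Proof.
move=> k0; split=> [x|x y].
  rewrite /clamp ger0_norm ?le_max ?lexx// ge_max ler01/= ge_min lexx//.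
have -> : k * `|x - y| = `|k * (x - a) - k * (y - a)|.
  by rewrite -mulrBr opprB addrA subrK normrM ger0_norm.
move: (k * (x - a)) (k * (y - a)) => u v.
have := ler_norm (u - v); have := ler_norm (v - u); rewrite (distrC v u) => uv vu.
have cE w : [\/ w <= 0 /\ clamp w = 0, 1 <= w /\ clamp w = 1 | 0 <= w <= 1 /\ clamp w = w].
  have [w0|w0] := leP w 0; first by constructor 1; rewrite /clamp min_r ?max_l// (le_trans w0).
  have [w1|w1] := leP 1 w; first by constructor 2; rewrite /clamp min_l// max_r.
  by constructor 3; rewrite /clamp min_r ?max_r ?ltW.
by rewrite ler_norml; have [[? ->]|[? ->]|[? ->]] := cE u; have [[? ->]|[? ->]|[? ->]] := cE v; lra.
Qed.

End bounded_lipschitz.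

(** * A law is determined by its characteristic function *)

Section characteristic_function_uniqueness.
Context {R : realType}.
Implicit Types mu nu : probability (measurableTypeR R) R.

Lemma measurable_cos_affine (t c : R) :
  measurable_fun setT ((fun x => cos (t * x + c)) : measurableTypeR R -> R).
Proof.
apply: continuous_measurable_fun => x; apply: continuous_comp; last exact: continuous_cos.
by apply: cvgD; [apply: cvgMr; exact: cvg_id|exact: cvg_cst].
Qed.

(** The real and imaginary parts of the characteristic function, kept apart so that derivatives and
    dominated convergence stay real-valued. *)
Definition icos mu t := Rintegral mu setT (fun x => cos (t * x)).
Definition isin mu t := Rintegral mu setT (fun x => sin (t * x)).

Lemma measurable_cosM (t : R) : measurable_fun setT ((fun x => cos (t * x)) : measurableTypeR R -> R).
Proof. by have := measurable_cos_affine t 0; under eq_fun do rewrite addr0. Qed.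

Lemma measurable_sinM (t : R) : measurable_fun setT ((fun x => sin (t * x)) : measurableTypeR R -> R).
Proof. by have := measurable_cos_affine t (- (pi/2)); under eq_fun do rewrite cosBpihalf. Qed.

Lemma integrable_cosM mu (t : R) : mu.-integrable setT (EFin \o (fun x => cos (t * x))).
Proof. apply: (@integrable_bounded _ _ _ _ _ 1); [exact: measurable_cosM|move=> x; exact: cos_max]. Qed.

Lemma integrable_sinM mu (t : R) : mu.-integrable setT (EFin \o (fun x => sin (t * x))).
Proof. apply: (@integrable_bounded _ _ _ _ _ 1); [exact: measurable_sinM|move=> x; exact: sin_max]. Qed.

Lemma Rintegral_cos_affine mu (t c : R) :
  Rintegral mu setT (fun x => cos (t * x + c)) = icos mu t * cos c - isin mu t * sin c.
Proof.
rewrite -!RintegralZr//; [|exact: integrable_sinM|exact: integrable_cosM].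
rewrite -RintegralB//; first by apply: eq_Rintegral => x _; rewrite cosD.
- apply: (@integrable_bounded _ _ _ _ _ 1) => [|x].
    by apply: measurable_funM => //; exact: measurable_cosM.
  by rewrite normrM mulr_ile1// cos_max.
- apply: (@integrable_bounded _ _ _ _ _ 1) => [|x].
    by apply: measurable_funM => //; exact: measurable_sinM.
  by rewrite normrM mulr_ile1// sin_max.
Qed.

Lemma trig_integrable mu f : trig f -> mu.-integrable setT (EFin \o f).
Proof.
elim=> {f} [a t s|f g _ If _ Ig].
  apply: (@integrable_bounded _ _ _ _ _ `|a|).
    by apply: measurable_funM => //; exact: measurable_cos_affine.
  by move=> x; rewrite normrM ler_piMr// cos_max.
by have := integrableD measurableT If Ig; apply: eq_integrable.
Qed.

Lemma eq_trig_integral mu nu : icos mu =1 icos nu -> isin mu =1 isin nu ->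
  forall f, trig f -> Rintegral mu setT f = Rintegral nu setT f.
Proof.
move=> hc hs f; elim=> {f} [a t s|f g tf IHf tg IHg].
  have I m : (m : probability (measurableTypeR R) R).-integrable setT (EFin \o (fun x => cos (t * x + s))).
    apply: (@integrable_bounded _ _ _ _ _ 1); first exact: measurable_cos_affine.
    by move=> x; exact: cos_max.
  rewrite (RintegralZl a measurableT (I mu)) (RintegralZl a measurableT (I nu)).
  by rewrite !Rintegral_cos_affine hc hs.
by rewrite !RintegralD ?IHf ?IHg//; exact: trig_integrable.
Qed.

Lemma eq_bdd_lip_integral mu nu : icos mu =1 icos nu -> isin mu =1 isin nu ->
  forall M L f, bdd_lip M L f -> Rintegral mu setT f = Rintegral nu setT f.
Proof.
move=> hc hs M L f fML.
have [f_ [f_trig f_ML f_f]] := trig_approx fML.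
have cv m : Rintegral (m : probability (measurableTypeR R) R) setT (f_ n) @[n --> \oo] --> Rintegral m setT f.
  apply: (@Rintegral_dominated_cvg _ _ _ m f_ f (cst M)) => //.
  - by move=> n; exact: bdd_lip_measurable (f_ML n).
  - exact: finite_measure_integrable_cst.
  - by move=> n x; have [/(_ x)] := f_ML n.
apply: (cvg_unique _ (cv mu)) => //=.
have -> : (fun n => Rintegral mu setT (f_ n)) = (fun n => Rintegral nu setT (f_ n)).
  by apply/funext => n; exact: eq_trig_integral.
exact: cv.
Qed.

(** Open half-lines are stable under intersection and generate the Borel sets, and their indicators
    are pointwise limits of ramps. *)
Lemma eq_measure_of_bdd_lip mu nu :
  (forall M L f, bdd_lip M L f -> Rintegral mu setT f = Rintegral nu setT f) ->
  forall A, measurable A -> mu A = nu A.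
Proof.
move=> H A mA.
pose g n : set (measurableTypeR R) := `](- n%:R), +oo[%classic.
apply: (@measure_unique _ R (measurableTypeR R) (@RGenOInfty.G R) g) => //.
- exact: RGenOInfty.measurableE.
- by move=> _ _ [x ->] [y ->]; exists (Num.max x y); apply/seteqP;
  split=> z /=; rewrite !in_itv/= !andbT gt_max; [by move=> [-> ->]|by move=> /andP[]].
- by move=> n; exists (- n%:R).
- apply/seteqP; split=> // x _; exists (Num.truncn `|x|).+1 => //=.
  rewrite /g/= in_itv/= andbT ltrNl (le_lt_trans (ler_norm _))// normrN.
  exact: truncnS_gt.
- move=> _ [a ->].
  have E m : Rintegral (m : probability (measurableTypeR R) R) setT (fun x => clamp (n%:R * (x - a)))
      @[n --> \oo] --> fine (m `]a, +oo[%classic).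
    have -> : fine (m `]a, +oo[%classic) = Rintegral m setT (\1_(`]a, +oo[%classic : set R)).
      by rewrite /Rintegral integral_indic// setIT.
    apply: (@Rintegral_dominated_cvg _ _ _ m (fun n x => clamp (n%:R * (x - a))) _ (cst 1)) => //.
    + by move=> n; apply: bdd_lip_measurable; exact: clamp_bdd_lip.
    + exact: finite_measure_integrable_cst.
    + by move=> n x; have [+ _] := @clamp_bdd_lip R n%:R a (ler0n _ _); exact.
    + move=> x; rewrite indicE.
      rewrite mem_setE in_itv/= andbT; have [ax|xa] := ltP a x.
        have xa0 : 0 < x - a by rewrite subr_gt0.
        apply: cvg_near_cst; near=> n.
        rewrite /clamp min_l ?max_r// -ler_pdivrMr//.
        by near: n; exact: nbhs_infty_ger.
      apply: cvg_near_cst; apply: nearW => n.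
      rewrite /clamp max_l// ge_min; apply/orP; right.
      by rewrite mulr_ge0_le0// subr_le0.
  have fin m : (m : probability (measurableTypeR R) R) `]a, +oo[%classic \is a fin_num by exact: fin_num_measure.
  rewrite -[LHS]fineK ?fin// -[RHS]fineK ?fin//; congr EFin.
  apply: (cvg_unique _ (E mu)) => //=.
  have -> : (fun n => Rintegral mu setT (fun x => clamp (n%:R * (x - a)))) =
            (fun n => Rintegral nu setT (fun x => clamp (n%:R * (x - a)))).
    by apply/funext => n; apply: H; exact: clamp_bdd_lip.
  exact: E.
- by move=> k; rewrite ltey_eq fin_num_measure//; exact: measurable_itv.
Unshelve. all: by end_near. Qed.

Lemma cf_uniqueness mu nu : icos mu =1 icos nu -> isin mu =1 isin nu ->
  forall A, measurable A -> mu A = nu A.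
Proof.
move=> hc hs; apply: eq_measure_of_bdd_lip => M L f; exact: eq_bdd_lip_integral.
Qed.

End characteristic_function_uniqueness.

(** * Probability measures from distribution functions *)

Section probability_of_cdf.
Context {R : realType} (G : R -> R).
Hypothesis G_nd : nondecreasing G.
Hypothesis G_rc : forall x, G @ at_right x --> G x.
Hypothesis G_Ny : G @ -oo --> (0 : R).
Hypothesis G_y : G @ +oo --> (1 : R).

Let F := G.
#[local] HB.instance Definition _ := isCumulative.Build R _ R F G_nd G_rc.
#[local] HB.instance Definition _ := isCumulativeBounded.Build R 0 1 F G_Ny G_y.

Lemma probability_of_cdf :
  exists rho : probability (measurableTypeR R) R, forall a, rho `]-oo, a]%classic = (G a)%:E.
Proof.
exists (lebesgue_stieltjes_measure F) => a.
have := cdf_lebesgue_stieltjes_id F a.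
by rewrite /cdf /distribution /pushforward preimage_id.
Qed.

End probability_of_cdf.

(** * Limits of tight sequences *)

Section step_approximation.
Context {R : realType}.
Variables (h : R -> R) (M L : R).
Hypothesis hML : bdd_lip M L h.
Variables (a eta delta : R).
Hypotheses (eta0 : 0 <= eta) (delta0 : 0 <= delta).

Let ind (y x : R) : R := (x <= y)%R%:R.
Let p i : R := a + i%:R * eta.

(* The offset [delta] avoids the jumps of [F]; it is sent to [0+] only after the
   limit of the distribution functions has been taken. *)
Definition grid_sum (F : R -> R) N : R :=
  \sum_(i < N) h (p i) * (F (p i.+1 + delta) - F (p i + delta)).

(** As a function of [y], [ind y x] is the distribution function of the point mass at [x]. Hence
    [s N] is the step function with value [h (p i)] on []p i + delta, p i.+1 + delta]], and,
    [grid_sum] being linear in [F], its integral is the grid sum of the distribution function of the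
    measure. *)
Let s N x := grid_sum (ind ^~ x) N.

Let le_p i : p i <= p i.+1.
Proof. by rewrite /p -natr1 lerD2l ler_wpM2r// lerDl. Qed.

Let le_p0 i : p 0%N <= p i.
Proof. by rewrite /p lerD2l ler_wpM2r. Qed.

Let L0 : 0 <= L.
Proof. by have [_ /(_ 1 0)] := hML; rewrite subr0 normr1 mulr1; apply: le_trans. Qed.

Let sS N x : s N.+1 x = s N x + h (p N) * (ind (p N.+1 + delta) x - ind (p N + delta) x).
Proof. by rewrite /s /grid_sum big_ord_recr. Qed.

Let s_spec N x : [/\ x <= p 0%N + delta -> s N x = 0,
  p N + delta < x -> s N x = 0 &
  p 0%N + delta < x <= p N + delta -> `|h x - s N x| <= L * (eta + delta)].
Proof.
elim: N => [|N [IH1 IH2 IH3]].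
  by rewrite /s /grid_sum !big_ord0; split=> // /andP[/lt_le_trans H /H]; rewrite ltxx.
rewrite sS /ind.
split=> [x0|xN|/andP[x0 xN]].
- rewrite IH1// !(le_trans x0) ?lerD2r//.
  by rewrite subrr mulr0 addr0.
- have xN' : p N + delta < x by rewrite (le_lt_trans _ xN)// lerD2r.
  by rewrite IH2// !leNgt xN xN'/= subrr mulr0 addr0.
- rewrite xN; have [xN'|xN'] := leP x (p N + delta).
    by rewrite subrr mulr0 addr0 IH3// x0.
  rewrite IH2// subr0 mulr1 add0r; have [_ /(_ x (p N)) /le_trans] := hML; apply.
  rewrite ler_wpM2l// ger0_norm; last by rewrite subr_ge0 (le_trans _ (ltW xN'))// lerDl.
  by move: xN; rewrite /p -natr1; lra.
Qed.

Let M0 : 0 <= M.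
Proof. by have [/(_ 0) + _] := hML; apply: le_trans. Qed.

Let s_bound N x : `|h x - s N x| <= L * (eta + delta) + M * (ind (p 0%N + delta) x + (1 - ind (p N + delta) x)).
Proof.
have [H1 H2 H3] := s_spec N x; have [hM _] := hML.
have A0 : 0 <= L * (eta + delta) by rewrite mulr_ge0// addr_ge0.
rewrite /ind; have [x0|x0] := leP x (p 0%N + delta).
  rewrite H1// subr0 (le_trans x0) ?lerD2r// subrr addr0 mulr1.
  by rewrite (le_trans (hM _))// lerDr.
have [xN|xN] := leP x (p N + delta); first by rewrite subrr addr0 mulr0 addr0 H3// x0.
by rewrite H2// !subr0 add0r mulr1 (le_trans (hM _))// lerDr.
Qed.

Variable m : probability (measurableTypeR R) R.
Let Fm y := fine (m `]-oo, y]%classic).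

Let ind_indic y : ind y = \1_(`]-oo, y]%classic : set R).
Proof. by apply/funext => x; rewrite indicE mem_setE in_itv/= /ind. Qed.

Let ind_int y : m.-integrable setT (EFin \o (ind y : measurableTypeR R -> R)).
Proof.
apply: (@integrable_bounded _ _ _ _ _ 1) => [|x].
  by rewrite ind_indic; exact: measurable_indic.
by rewrite /ind; case: (x <= y); rewrite ?normr1 ?normr0.
Qed.

Let ind_Fm y : Rintegral m setT (ind y) = Fm y.
Proof. by rewrite ind_indic /Rintegral integral_indic// setIT. Qed.

Let s_int N : m.-integrable setT (EFin \o (s N : measurableTypeR R -> R)) /\
  Rintegral m setT (s N) = grid_sum Fm N.
Proof.
elim: N => [|N [IH1 IH2]].
  rewrite /s /grid_sum big_ord0; have -> : (fun x => \sum_(i < 0) h (p i) * (ind (p i.+1 + delta) x - ind (p i + delta) x)) = (cst 0 : measurableTypeR R -> R).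
    by apply/funext => x; rewrite big_ord0.
  by split; [exact: finite_measure_integrable_cst|rewrite Rintegral_cst// mul0r].
have sE : s N.+1 = (fun x => s N x + h (p N) * (ind (p N.+1 + delta) x - ind (p N + delta) x)).
  by apply/funext => x; rewrite /s /grid_sum big_ord_recr.
have I1 : m.-integrable setT (EFin \o (fun x : measurableTypeR R => ind (p N.+1 + delta) x - ind (p N + delta) x)).
  by have := integrableB measurableT (ind_int (p N.+1 + delta)) (ind_int (p N + delta)); apply: eq_integrable.
have I2 : m.-integrable setT (EFin \o (fun x : measurableTypeR R => h (p N) * (ind (p N.+1 + delta) x - ind (p N + delta) x))).
  by have := integrableZl measurableT (h (p N)) I1; apply: eq_integrable.
rewrite sE; split; first by have := integrableD measurableT IH1 I2; apply: eq_integrable.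
rewrite RintegralD// IH2 RintegralZl// RintegralB//.
by rewrite !ind_Fm /grid_sum big_ord_recr.
Qed.

(** Apart from the integral of [h], the measure enters only through finitely many values of its
    distribution function, so the estimate passes to pointwise limits. Inside the grid the Lipschitz
    bound is used; the two tails cost [M] each. *)
Lemma grid_sum_approx N : `|Rintegral m setT h - grid_sum Fm N| <=
  L * (eta + delta) + M * (Fm (a + delta) + (1 - Fm (a + N%:R * eta + delta))).
Proof.
have [sI <-] := s_int N.
have hI : m.-integrable setT (EFin \o (h : measurableTypeR R -> R)).
  by apply: (@integrable_bounded _ _ _ _ _ M); [exact: bdd_lip_measurable hML|case: hML].
have dI : m.-integrable setT (EFin \o (fun x : measurableTypeR R => h x - s N x)).
  by have := integrableB measurableT hI sI; apply: eq_integrable.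
rewrite -RintegralB//.
apply: (le_trans (le_normr_Rintegral measurableT dI)).
pose b1 : measurableTypeR R -> R := cst (L * (eta + delta) + M).
pose b2 : measurableTypeR R -> R := fun x => M * ind (p 0%N + delta) x.
pose b3 : measurableTypeR R -> R := fun x => M * ind (p N + delta) x.
have I1 : m.-integrable setT (EFin \o b1) by exact: finite_measure_integrable_cst.
have I2 : m.-integrable setT (EFin \o b2).
  by have := integrableZl measurableT M (ind_int (p 0%N + delta)); apply: eq_integrable.
have I3 : m.-integrable setT (EFin \o b3).
  by have := integrableZl measurableT M (ind_int (p N + delta)); apply: eq_integrable.
have I12 : m.-integrable setT (EFin \o (fun x => b1 x + b2 x)).
  by have := integrableD measurableT I1 I2; apply: eq_integrable.
have I123 : m.-integrable setT (EFin \o (fun x => b1 x + b2 x - b3 x)).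
  by have := integrableB measurableT I12 I3; apply: eq_integrable.
apply: (@le_trans _ _ (Rintegral m setT (fun x => b1 x + b2 x - b3 x))).
  apply: le_Rintegral => //; first exact: integrable_norm.
  move=> x _; apply: (le_trans (s_bound N x)).
  by rewrite /b1 /b2 /b3 /=; lra.
rewrite RintegralB// RintegralD// !RintegralZl//.
rewrite !ind_Fm Rintegral_cst//= probability_setT /= mulr1 /p mul0r addr0; lra.
Qed.

End step_approximation.

(** Compactness of the segment gives a cluster point, and a cluster point of an ultrafilter is a
    limit. *)
Lemma ultrafilter_cvg (T : Type) (R : realType) (U : set_system T) (UF : UltraFilter U)
  (f : T -> R) (lo hi : R) :
  (forall n, lo <= f n <= hi) -> exists l : R, f @ U --> l.
Proof.
move=> fb.
have [|l [_ cl]] := @segment_compact R lo hi (f @ U) _.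
  by rewrite /fmap/=; apply: (filterS _ filterT) => n _ /=; rewrite in_itv/=; exact: fb.
exists l => N Nl; have [//|UN] := in_ultra_setVsetC (f @^-1` N) UF.
by have [y [/= ny Ny]] := cl (~` N) N UN Nl.
Qed.

Lemma cvg_ler (T : topologicalType) (U : set_system T) (R : realType) (f g : T -> R) (l l' : R) :
  ProperFilter U -> f @ U --> l -> g @ U --> l' -> (\forall x \near U, f x <= g x) -> l <= l'.
Proof. by move=> UP fl gl fg; have := @ler_cvg_to _ _ UP _ _ _ _ _ fl gl; apply. Qed.

Section tight_sequence.
Context {R : realType} (mu_ : nat -> probability (measurableTypeR R) R).
Let F n y := fine (mu_ n `]-oo, y]%classic).
Hypothesis tight : forall e, 0 < e -> exists K, forall n, F n (- K) <= e /\ 1 - e <= F n K.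

Let F01 n y : 0 <= F n y <= 1.
Proof.
rewrite /F fine_ge0//= -lee_fin fineK ?fin_num_measure//.
exact: probability_le1.
Qed.

Let F_nd n x y : x <= y -> F n x <= F n y.
Proof.
move=> xy; rewrite /F fine_le ?fin_num_measure// le_measure ?inE//.
by apply: subset_itvl; rewrite bnd_simp.
Qed.

(* Helly's selection: the limit along an ultrafilter replaces the extraction of a
   subsequence. *)
Let UE := cid (ultraFilterLemma (F := \oo) _).
Let U : set_system nat := projT1 UE.
Let UF : UltraFilter U. Proof. by have [] := projT2 UE. Qed.
#[local] Existing Instance UF.
Let UP : ProperFilter U. Proof. exact: ultra_proper. Qed.
Let ooU : \oo `<=` U. Proof. by have [] := projT2 UE. Qed.

Let Fl y : R := projT1 (cid (@ultrafilter_cvg nat R U UF (F ^~ y) 0 1 (F01 ^~ y))).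
Let F_Fl y : F n y @[n --> U] --> Fl y.
Proof. exact: (projT2 (cid (@ultrafilter_cvg nat R U UF (F ^~ y) 0 1 (F01 ^~ y)))). Qed.

Let Fl_nd x y : x <= y -> Fl x <= Fl y.
Proof. by move=> xy; have := cvg_ler UP (@F_Fl x) (@F_Fl y); apply; apply: nearW => n; exact: F_nd. Qed.

Let Fl_ge y c : (forall n, c <= F n y) -> c <= Fl y.
Proof. by move=> cF; have := cvg_ler UP (cvg_cst c) (@F_Fl y); apply; exact: nearW. Qed.

Let Fl_le y c : (forall n, F n y <= c) -> Fl y <= c.
Proof. by move=> cF; have := cvg_ler UP (@F_Fl y) (cvg_cst c); apply; exact: nearW. Qed.

Let Fl01 y : 0 <= Fl y <= 1.
Proof. by rewrite Fl_ge ?Fl_le// => n; have /andP[] := F01 n y. Qed.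

Let Fl_cvg a : cvg (Fl x @[x --> a^'+]).
Proof.
apply: nondecreasing_at_right_is_cvgr; apply: nearW => x.
  by move=> u v _ _; exact: Fl_nd.
by exists 0 => _ [y _ <-]; have /andP[] := Fl01 y.
Qed.

(** The pointwise limit [Fl] is monotone but may fail to be right-continuous; passing to right
    limits repairs this. *)
Let G a := lim (Fl x @[x --> a^'+]).

Let Fl_G a : Fl x @[x --> a^'+] --> G a. Proof. exact: Fl_cvg. Qed.

Let Fl_le_G a : Fl a <= G a.
Proof.
have := cvg_ler (at_right_proper_filter a) (cvg_cst (Fl a)) (@Fl_G a); apply.
by near=> x; apply: Fl_nd; apply: ltW; near: x; exact: nbhs_right_gt.
Unshelve. all: by end_near. Qed.

Let G_le_Fl a y : a < y -> G a <= Fl y.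
Proof.
move=> ay; have := cvg_ler (at_right_proper_filter a) (@Fl_G a) (cvg_cst (Fl y)); apply.
by near=> x; apply: Fl_nd; near: x; exact: nbhs_right_le.
Unshelve. all: by end_near. Qed.

Let G_nd : nondecreasing G.
Proof.
move=> x y; rewrite le_eqVlt => /predU1P[->//|xy].
exact: le_trans (G_le_Fl xy) (Fl_le_G y).
Qed.

Let G01 a : 0 <= G a <= 1.
Proof.
have /andP[H1 _] := Fl01 a; have /andP[_ H2] := Fl01 (a + 1).
by apply/andP; split; [exact: le_trans H1 (Fl_le_G a)|apply: le_trans H2; apply: G_le_Fl; rewrite ltrDl].
Qed.

Let G_rc a : G @ at_right a --> G a.
Proof.
apply/cvgrPdist_le => e e0; have /cvgrPdist_le/(_ _ e0) := @Fl_G a.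
move=> [d /= d0 H]; near=> x.
have ax : a < x by near: x; exact: nbhs_right_gt.
have xd : x < a + d / 2 by near: x; apply: nbhs_right_lt; rewrite ltrDl divr_gt0.
rewrite distrC ger0_norm; last by rewrite subr_ge0; apply: G_nd; exact: ltW.
have := H (a + d / 2); rewrite /= opprD addNKr normrN ger0_norm; last by rewrite ltW// divr_gt0.
rewrite ltr_pdivrMr// ltr_pMr// ltr1n ltrDl divr_gt0// => /(_ isT isT).
rewrite distrC => /(le_trans (ler_norm _)); apply: le_trans.
by rewrite lerD2r; exact: G_le_Fl.
Unshelve. all: by end_near. Qed.

(** Tightness enters here and in [G_y]: no mass escapes to infinity, so [G] has total mass 1. *)
Let G_Ny : G @ -oo --> (0 : R).
Proof.
apply/cvgrPdist_le => e e0; have [K HK] := tight e0.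
near=> x; rewrite sub0r normrN ger0_norm; last by have /andP[] := G01 x.
rewrite (@le_trans _ _ (Fl (- K)))//; last by apply: Fl_le => n; have [] := HK n.
by apply: G_le_Fl; near: x; apply: nbhs_ninfty_lt; exact: num_real.
Unshelve. all: by end_near. Qed.

Let G_y : G @ +oo --> (1 : R).
Proof.
apply/cvgrPdist_le => e e0; have [K HK] := tight e0.
near=> x; rewrite ger0_norm; last by rewrite subr_ge0; have /andP[] := G01 x.
rewrite lerBlDr -lerBlDl (@le_trans _ _ (Fl K))//; first by apply: Fl_ge => n; have [] := HK n.
apply: (le_trans (Fl_le_G _)); apply: G_nd.
by near: x; apply: nbhs_pinfty_ge; exact: num_real.
Unshelve. all: by end_near. Qed.

Let grid_sum_cvg (h : R -> R) a eta delta N :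
  grid_sum h a eta delta (F n) N @[n --> U] --> grid_sum h a eta delta Fl N.
Proof.
elim: N => [|N IH].
  rewrite /grid_sum; under eq_fun do rewrite big_ord0.
  by rewrite big_ord0; exact: cvg_cst.
rewrite /grid_sum; under eq_fun do rewrite big_ord_recr.
rewrite big_ord_recr/=; apply: cvgD; first exact: IH.
by apply: cvgMr; apply: cvgB; exact: F_Fl.
Qed.

Let shift_cvg x : Fl (x + d) @[d --> 0^'+] --> G x.
Proof.
apply/cvgrPdist_le => e e0; have /cvgrPdist_le/(_ _ e0) := @Fl_G x.
move=> [d /= d0 H]; exists d => //= y /=.
rewrite sub0r normrN => yd y0; apply: H; last by rewrite ltrDl.
by rewrite /= opprD addNKr normrN.
Qed.

Let grid_sum_shift_cvg (h : R -> R) a eta N :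
  grid_sum h a eta delta Fl N @[delta --> 0^'+] --> grid_sum h a eta 0 G N.
Proof.
elim: N => [|N IH].
  rewrite /grid_sum; under eq_fun do rewrite big_ord0.
  by rewrite big_ord0; exact: cvg_cst.
rewrite /grid_sum; under eq_fun do rewrite big_ord_recr.
rewrite big_ord_recr/=; apply: cvgD; first exact: IH.
by rewrite !addr0; apply: cvgMr; apply: cvgB; exact: shift_cvg.
Qed.

(** The law is chosen before [h]. Convergence of the integrals of [h] is assumed, so their limit
    along the ultrafilter has to be [l]; both [l] and the integral against [rho] are compared with
    the same grid sum of [G]. *)
Lemma tight_limit : exists rho : probability (measurableTypeR R) R,
  forall M L h l, bdd_lip M L h -> Rintegral (mu_ n) setT h @[n --> \oo] --> l ->
    Rintegral rho setT h = l.
Proof.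
have [rho rhoG] := probability_of_cdf G_nd G_rc G_Ny G_y.
exists rho => M L h l hML cvl.
have M0 : 0 <= M by have [/(_ 0) + _] := hML; apply: le_trans.
have L0 : 0 <= L by have [_ /(_ 1 0)] := hML; rewrite subr0 normr1 mulr1; apply: le_trans.
apply/eqP; rewrite -subr_eq0 -normr_le0; apply/ler_addgt0Pl => e e0; rewrite addr0.
(* With [eta] and [e'] the Lipschitz error and the tail error are each at most [e / 4]; the
   comparison is made twice. Adding 1 keeps the denominators positive when [L] or [M] is 0. *)
pose eta := e / (4 * (L + 1)).
have eta0 : 0 < eta by rewrite divr_gt0// mulr_gt0// ltr_wpDl.
pose e' := e / (8 * (M + 1)).
have e'0 : 0 < e' by rewrite divr_gt0// mulr_gt0// ltr_wpDl.
have [K0 HK0] := tight e'0.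
(* The added 1 makes [- K < - K0] strict, as bounding [G] by [Fl] requires. [N] is then large enough
   for the grid starting at [- K] to reach [K]. *)
pose K := `|K0| + 1.
pose N := (Num.truncn (2 * K / eta)).+1.
have aN : K <= - K + N%:R * eta.
  have : 2 * K / eta < N%:R by exact: truncnS_gt.
  by rewrite ltr_pdivrMr//; lra.
have GK1 : G (- K) <= e'.
  rewrite (@le_trans _ _ (Fl (- K0)))//; last by apply: Fl_le => n; have [] := HK0 n.
  by apply: G_le_Fl; rewrite /K; have := ler_norm K0; lra.
have GK2 : 1 - e' <= G (- K + N%:R * eta).
  rewrite (@le_trans _ _ (Fl K0))//; first by apply: Fl_ge => n; have [] := HK0 n.
  apply: (le_trans (Fl_le_G _)); apply: G_nd; apply: le_trans aN.
  by rewrite /K; have := ler_norm K0; lra.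
pose S := grid_sum h (- K) eta 0 G N.
have bound (D := L * (eta + 0) + M * (G (- K) + (1 - G (- K + N%:R * eta)))) : D <= e / 2.
  have : L * eta <= e / 4.
    rewrite /eta mulrA ler_pdivrMr; last by rewrite mulr_gt0// ltr_wpDl.
    have -> : e / 4 * (4 * (L + 1)) = L * e + e by field.
    by rewrite lerDl ltW.
  have : M * (G (- K) + (1 - G (- K + N%:R * eta))) <= M * (2 * e').
    by rewrite ler_wpM2l//; lra.
  have : M * (2 * e') <= e / 4.
    rewrite /e' 2!mulrA ler_pdivrMr; last by rewrite mulr_gt0// ltr_wpDl.
    have -> : e / 4 * (8 * (M + 1)) = M * (2 * e) + 2 * e by field.
    by rewrite lerDl mulr_ge0// ltW.
  by rewrite /D addr0; lra.
have H1 : `|Rintegral rho setT h - S| <= e / 2.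
  apply: le_trans bound.
  have := @grid_sum_approx _ h M L hML (- K) eta 0 (ltW eta0) (lexx _) rho N.
  rewrite /= !addr0.
  have -> : (fun y => fine (rho `]-oo, y]%classic)) = G by apply/funext => y; rewrite rhoG.
  by rewrite !rhoG.
have H2 : `|l - S| <= e / 2.
  apply: le_trans bound.
  have cvlU : Rintegral (mu_ n) setT h @[n --> U] --> l by apply: cvg_trans cvl; exact: cvg_app ooU.
  have step delta : 0 <= delta -> `|l - grid_sum h (- K) eta delta Fl N| <=
      L * (eta + delta) + M * (Fl (- K + delta) + (1 - Fl (- K + N%:R * eta + delta))).
    move=> d0.
    have c1 : `|Rintegral (mu_ n) setT h - grid_sum h (- K) eta delta (F n) N| @[n --> U] -->
       `|l - grid_sum h (- K) eta delta Fl N|.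
      by apply: cvg_norm; apply: cvgB => //; exact: grid_sum_cvg.
    have c2 : L * (eta + delta) + M * (F n (- K + delta) + (1 - F n (- K + N%:R * eta + delta))) @[n --> U]
      --> L * (eta + delta) + M * (Fl (- K + delta) + (1 - Fl (- K + N%:R * eta + delta))).
      apply: cvgD; first exact: cvg_cst.
      by apply: cvgMr; apply: cvgD; [exact: F_Fl|apply: cvgB; [exact: cvg_cst|exact: F_Fl]].
    have := cvg_ler UP c1 c2; apply; apply: nearW => n.
    exact: (@grid_sum_approx _ h M L hML (- K) eta delta (ltW eta0) d0 (mu_ n) N).
  have c1 : `|l - grid_sum h (- K) eta delta Fl N| @[delta --> 0^'+] --> `|l - S|.
    by apply: cvg_norm; apply: cvgB; [exact: cvg_cst|exact: grid_sum_shift_cvg].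
  have c2 : L * (eta + delta) + M * (Fl (- K + delta) + (1 - Fl (- K + N%:R * eta + delta)))
     @[delta --> 0^'+] --> L * (eta + 0) + M * (G (- K) + (1 - G (- K + N%:R * eta))).
    apply: cvgD.
      apply: cvgMr; apply: cvgD; first exact: cvg_cst.
      exact: cvg_at_right_filter.
    by apply: cvgMr; apply: cvgD; [exact: shift_cvg|apply: cvgB; [exact: cvg_cst|exact: shift_cvg]].
  have := cvg_ler (at_right_proper_filter 0) c1 c2; apply.
  near=> delta; apply: step; near: delta; exact: nbhs_right_ge.
have -> : Rintegral rho setT h - l = (Rintegral rho setT h - S) - (l - S) by ring.
rewrite (le_trans (ler_normB _ _))//; lra.
Unshelve. all: by end_near. Qed.

End tight_sequence.

(** * Characteristic functions, convolution and tightness *)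

Section convolution_characteristic_function.
Context {R : realType}.
Implicit Types mu nu : probability (measurableTypeR R) R.

Lemma integral_convolution mu nu (f : R -> R) M :
  measurable_fun setT (f : measurableTypeR R -> R) -> (forall x, `|f x| <= M) ->
  Rintegral (convolution mu nu) setT f =
  Rintegral mu setT (fun x => Rintegral nu setT (fun y => f (x + y))).
Proof.
move=> mf fM.
pose g : measurableTypeR R * measurableTypeR R -> R := f \o @Defs.add_pair R.
have mg : measurable_fun setT g by apply: measurableT_comp => //; exact: measurable_add_pair.
have ig : (mu \x nu)%E.-integrable setT (EFin \o g).
  by apply: (@integrable_bounded _ _ _ (mu \x nu)%E g M) => // x; exact: fM.
rewrite /Rintegral; congr fine.
rewrite (@integral_distribution _ _ _ _ _ (mu \x nu)%E (@Defs.add_pair R) (EFin \o f)); last 2 first.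
- exact/measurable_EFinP.
- exact: ig.
rewrite -[LHS]/(\int[mu \x nu]_z (EFin \o g) z)%E.
rewrite -integral12_prod_meas1//.
apply: eq_integral => x _; rewrite /fubini_F /=.
rewrite fineK//; apply: integrable_fin_num => //.
apply: (@integrable_bounded _ _ _ nu (fun y => f (x + y)) M) => //.
apply: measurableT_comp => //.
by apply: measurable_funD.
Qed.

Lemma icos_convolution mu nu t :
  icos (convolution mu nu) t = icos mu t * icos nu t - isin mu t * isin nu t.
Proof.
rewrite /icos (@integral_convolution _ _ _ 1); [|exact: measurable_cosM|by move=> x; exact: cos_max].
rewrite -!RintegralZr//; [|exact: integrable_sinM|exact: integrable_cosM].
rewrite -RintegralB//.
- apply: eq_Rintegral => x _.
  under eq_Rintegral do rewrite mulrDr addrC.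
  by rewrite Rintegral_cos_affine /icos /isin; ring.
- have := integrableZl measurableT (icos nu t) (integrable_cosM mu t).
  by apply: eq_integrable => // x _ /=; rewrite EFinM muleC.
- have := integrableZl measurableT (isin nu t) (integrable_sinM mu t).
  by apply: eq_integrable => // x _ /=; rewrite EFinM muleC.
Qed.

Lemma isin_convolution mu nu t :
  isin (convolution mu nu) t = isin mu t * icos nu t + icos mu t * isin nu t.
Proof.
rewrite /isin (@integral_convolution _ _ _ 1); [|exact: measurable_sinM|by move=> x; exact: sin_max].
rewrite -!RintegralZr//; [|exact: integrable_cosM|exact: integrable_sinM].
rewrite -RintegralD//.
- apply: eq_Rintegral => x _.
  under eq_Rintegral do rewrite mulrDr addrC -cosBpihalf -addrA.
  by rewrite Rintegral_cos_affine /icos /isin cosBpihalf sinBpihalf; ring.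
- have := integrableZl measurableT (icos nu t) (integrable_sinM mu t).
  by apply: eq_integrable => // x _ /=; rewrite EFinM muleC.
- have := integrableZl measurableT (isin nu t) (integrable_cosM mu t).
  by apply: eq_integrable => // x _ /=; rewrite EFinM muleC.
Qed.

Lemma Rintegral_dirac (a : R) (f : R -> R) :
  measurable_fun setT (f : measurableTypeR R -> R) ->
  Rintegral (\d_(a : measurableTypeR R)) setT f = f a.
Proof.
move=> mf; rewrite /Rintegral integral_dirac//; last exact/measurable_EFinP.
by rewrite diracT mul1e.
Qed.

Definition cf mu (t : R) : R[i] := (icos mu t +i* isin mu t)%C.

Lemma cf_convolution mu nu t : cf (convolution mu nu) t = cf mu t * cf nu t.
Proof.
apply/eqP; rewrite eq_complex /= icos_convolution isin_convolution.
by rewrite eqxx/= addrC.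
Qed.

Lemma cf_dirac (a t : R) : cf \d_(a : measurableTypeR R) t = (cos (t * a) +i* sin (t * a))%C.
Proof.
by rewrite /cf /icos /isin !Rintegral_dirac//; [exact: measurable_sinM|exact: measurable_cosM].
Qed.

Lemma cf_convolution_power mu n t : cf (convolution_power mu n) t = cf mu t ^+ n.
Proof.
elim: n => [|n IH]; first by rewrite /convolution_power/= cf_dirac mulr0 cos0 sin0 expr0.
by rewrite /convolution_power iterS cf_convolution -/(convolution_power mu n) IH exprS.
Qed.

(** The value phi (t) is projected on its own direction: with r its modulus, r ^ 2 is the integral
    of [C cos + S sin], which Lagrange's identity bounds pointwise by r. Thus r ^ 2 <= r. *)
Lemma norm_cf_le1 mu t : icos mu t ^+ 2 + isin mu t ^+ 2 <= 1.
Proof.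
set C := icos mu t; set S := isin mu t.
pose r := Num.sqrt (C ^+ 2 + S ^+ 2).
have r0 : 0 <= r by exact: sqrtr_ge0.
have rE : r ^+ 2 = C ^+ 2 + S ^+ 2 by rewrite sqr_sqrtr// addr_ge0// sqr_ge0.
have I1 : mu.-integrable setT (EFin \o (fun x => C * cos (t * x))).
  by have := integrableZl measurableT C (integrable_cosM mu t); apply: eq_integrable.
have I2 : mu.-integrable setT (EFin \o (fun x => S * sin (t * x))).
  by have := integrableZl measurableT S (integrable_sinM mu t); apply: eq_integrable.
have E : r ^+ 2 = Rintegral mu setT (fun x => C * cos (t * x) + S * sin (t * x)).
  transitivity (C ^+ 2 + S ^+ 2); first exact: rE.
  rewrite RintegralD// RintegralZl//; last exact: integrable_cosM.
  rewrite RintegralZl//; last exact: integrable_sinM.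
have : r ^+ 2 <= r.
  have rI : r = Rintegral mu setT (cst r) by rewrite Rintegral_cst//= probability_setT mulr1.
  rewrite E [X in _ <= X]rI.
  apply: le_Rintegral => //.
  - by have := integrableD measurableT I1 I2; apply: eq_integrable.
  - exact: finite_measure_integrable_cst.
  - move=> x _; set v := _ + _; rewrite /= leNgt; apply/negP => rv.
    have : r ^+ 2 < v ^+ 2 by rewrite ltr_pXn2r// nnegrE// (le_trans r0)// ltW.
    rewrite rE; have -> : v ^+ 2 = C ^+ 2 + S ^+ 2 - (C * sin (t * x) - S * cos (t * x)) ^+ 2.
      rewrite /v; have := cos2Dsin2 (t * x); set c := cos _; set s := sin _ => cs.
      have -> : (C * c + S * s) ^+ 2 = (C ^+ 2 + S ^+ 2) * (c ^+ 2 + s ^+ 2) - (C * s - S * c) ^+ 2 by ring.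
      by rewrite cs mulr1.
    by rewrite ltNge gerBl sqr_ge0.
rewrite -rE expr2 => rr; rewrite (le_trans rr)// leNgt; apply/negP => r1.
by move: rr; rewrite leNgt ltr_pMr ?r1// (lt_trans ltr01).
Qed.

End convolution_characteristic_function.

Section tightness_criterion.
Context {R : realType} (mu_ : nat -> probability (measurableTypeR R) R).

(** Markov's inequality for the nonnegative function 1 - cos, which is at least 1 on this set. *)
Lemma markov_cos (mu : probability (measurableTypeR R) R) (t : R) :
  (mu [set x : measurableTypeR R | (cos (t * x) <= 0)%R] <= (1 - icos mu t)%:E)%E.
Proof.
have mB : measurable [set x : measurableTypeR R | cos (t * x) <= 0].
  rewrite -[X in measurable X]setTI.
  by apply: measurable_fun_le => //; exact: measurable_cosM.
have I1 : mu.-integrable setT (EFin \o (fun x => 1 - cos (t * x))).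
  have := integrableB measurableT (finite_measure_integrable_cst mu 1 measurableT) (integrable_cosM mu t).
  exact: eq_integrable.
have -> : (1 - icos mu t) = Rintegral mu setT (fun x => 1 - cos (t * x)).
  rewrite RintegralB//; [|exact: finite_measure_integrable_cst|exact: integrable_cosM].
  by rewrite Rintegral_cst//= probability_setT mul1r.
rewrite /Rintegral fineK; last exact: integrable_fin_num.
pose B : set (measurableTypeR R) := [set x | cos (t * x) <= 0].
have -> : mu [set x : measurableTypeR R | (cos (t * x) <= 0)%R] = (\int[mu]_x (\1_B x)%:E)%E.
  by rewrite integral_indic// setIT.
apply: ge0_le_integral => //.
- by apply/measurable_EFinP; exact: measurable_indic.
- by have /measurable_int := I1.
- move=> x _; rewrite lee_fin indicE; case: (boolP (x \in _)) => [|_].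
    by rewrite inE /B /= => cx; rewrite lerBrDl gerDr.
  by rewrite subr_ge0 cos_le1.
Qed.

(* The frequencies [d / 2 ^ j] see every [x] with [|x| >= 2 / d]: for one of them
   the phase lies between [pi / 2] and [pi]. *)
Lemma dyadic_frequency (d x : R) : 0 < d -> 2 <= d * `|x| ->
  exists j, cos (d / 2 ^+ j * x) <= 0.
Proof.
move=> d0 dx.
have ex : exists j, d * `|x| / 2 ^+ j <= pi.
  pose j := (Num.truncn (d * `|x|)).+1; exists j.
  rewrite ler_pdivrMr ?exprn_gt0//.
  have H1 : d * `|x| < j%:R by exact: truncnS_gt.
  have H2 : (j%:R : R) <= 2 ^+ j by rewrite -natrX ler_nat ltnW// ltn_expl.
  apply: (le_trans (ltW H1)); apply: (le_trans H2).
  by rewrite ler_peMl ?exprn_ge0//; apply: le_trans (pi_ge2 R); rewrite ler1n.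
(* For the least [j] with phase at most pi, the previous phase exceeds pi, so this one exceeds pi /
   2. At [j = 0] the hypothesis and pi / 2 < 2 give the same. *)
case: (ex_minnP ex) => j jpi jmin; exists j.
rewrite -cos_norm normrM (ger0_norm (divr_ge0 (ltW d0) (exprn_ge0 _ _)))//.
have -> : d / 2 ^+ j * `|x| = d * `|x| / 2 ^+ j by rewrite mulrAC.
have ypi : pi / 2 <= d * `|x| / 2 ^+ j.
  case: j jmin {jpi} => [_|j jmin]; first by rewrite expr0 divr1 (le_trans _ dx)// ltW// pihalf_lt2.
  rewrite leNgt; apply/negP => yp; have := jmin j; rewrite ltnn => H; suff /H : d * `|x| / 2 ^+ j <= pi by [].
  move: yp; rewrite exprS ltr_pdivlMr// => /ltW; apply: le_trans.
  by rewrite le_eqVlt; apply/orP; left; apply/eqP; field; rewrite expf_neq0.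
set y := d * `|x| / 2 ^+ j in jpi ypi *.
have -> : y = (y - pi / 2) + pi / 2 by rewrite subrK.
rewrite cosDpihalf oppr_le0 sin_ge0_pi// subr_ge0 ypi/=.
by rewrite (le_trans _ jpi)// gerBl divr_ge0// pi_ge0.
Qed.

(** The set where [d * |x|] is at least 2 is covered by the events of [markov_cos] at dyadic
    frequencies. The linear bound near 0 makes their probabilities a geometric series, in place of
    the usual average over frequencies. *)
Lemma tightness_criterion (K : R) :
  (forall n t, `|t| <= 1 -> 1 - icos (mu_ n) t <= K * `|t|) ->
  forall e, 0 < e -> exists K', forall n,
    fine (mu_ n `]-oo, (- K')]%classic) <= e /\ 1 - e <= fine (mu_ n `]-oo, K']%classic).
Proof.
move=> H e e0.
(* [d <= 1] keeps every frequency in the range of the hypothesis, and [K * d <= e / 2] bounds the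
   term of index j by e / 2 ^ (j + 1), a series of sum [e]. *)
pose d := Num.min 1 (e / (2 * (`|K| + 1))).
have K1 : 0 < `|K| + 1 by rewrite ltr_wpDl.
have d0 : 0 < d by rewrite lt_min ltr01/= divr_gt0// mulr_gt0.
have d1 : d <= 1 by rewrite ge_min lexx.
have Kd : K * d <= e / 2.
  apply: (@le_trans _ _ ((`|K| + 1) * (e / (2 * (`|K| + 1))))).
    apply: (@le_trans _ _ ((`|K| + 1) * d)).
      by rewrite ler_wpM2r ?ltW// (le_lt_trans (ler_norm _))// ltrDl.
    by apply: ler_wpM2l; [exact: ltW|rewrite /d ge_min lexx orbT].
  by rewrite le_eqVlt; apply/orP; left; apply/eqP; field; rewrite gt_eqF.
have key n : (mu_ n [set x : measurableTypeR R | 2 <= d * `|x|]%R <= e%:E)%E.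
  pose B j : set (measurableTypeR R) := [set x | cos (d / 2 ^+ j * x) <= 0].
  have mB j : measurable (B j).
    rewrite -[X in measurable X]setTI.
    by apply: measurable_fun_le => //; exact: measurable_cosM.
  have mA : measurable [set x : measurableTypeR R | 2 <= d * `|x|].
    rewrite -[X in measurable X]setTI.
    by apply: measurable_fun_le => //; apply: measurable_funM => //; exact: measurableT_comp.
  apply: (@le_trans _ _ (\sum_(0 <= j <oo) mu_ n (B j))%E).
    apply: measure_sigma_subadditive => //.
    by move=> x /= /(dyadic_frequency d0)[j jx]; exists j.
  apply: (@le_trans _ _ (\sum_(0 <= j <oo) (e / (2 ^ j.+1)%:R)%:E)%E); last by apply: epsilon_trick0; exact: ltW.
  apply: lee_nneseries => // j _.
  apply: (le_trans (markov_cos _ _)); rewrite lee_fin.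
  have tj0 : 0 < d / 2 ^+ j by rewrite divr_gt0// exprn_gt0.
  apply: (le_trans (H _ _ _)).
    rewrite gtr0_norm// ler_pdivrMr ?exprn_gt0// mul1r (le_trans d1)//.
    by rewrite exprn_ege1// ler1n.
  rewrite gtr0_norm// mulrA expnS natrM natrX invfM mulrA ler_pM2r ?invr_gt0 ?exprn_gt0//.
exists (2 / d) => n; split.
  rewrite -lee_fin fineK ?fin_num_measure//; apply: le_trans (key n).
  apply: le_measure; rewrite ?inE//.
    rewrite -[X in measurable X]setTI.
    by apply: measurable_fun_le => //; apply: measurable_funM => //; exact: measurableT_comp.
  move=> x /=; rewrite in_itv/= => xd.
  have : 2 / d <= - x by rewrite lerNr.
  rewrite ler_pdivrMr// mulrC => /le_trans; apply.
  by apply: ler_wpM2l; [exact: ltW|rewrite -normrN; exact: ler_norm].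
rewrite lerBlDr -lerBlDl.
have -> : 1 - fine (mu_ n `]-oo, (2 / d)]%classic) = fine (mu_ n `](2 / d), +oo[%classic).
  have := probability_setC (mu_ n) (measurable_itv `]-oo, (2 / d)]).
  rewrite setCitvl => ->; rewrite fineB ?fin_num_measure//.
rewrite -lee_fin fineK ?fin_num_measure//; apply: le_trans (key n).
apply: le_measure; rewrite ?inE//.
  rewrite -[X in measurable X]setTI.
  by apply: measurable_fun_le => //; apply: measurable_funM => //; exact: measurableT_comp.
move=> x /=; rewrite in_itv/= andbT => /ltW.
rewrite ler_pdivrMr// mulrC => /le_trans; apply.
by apply: ler_wpM2l; [exact: ltW|exact: ler_norm].
Qed.

End tightness_criterion.

(** * Existence of the law with a given Levy exponent *)

Section complex_exponential.
Context {R : realType}.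
Implicit Types z w : R[i].
Local Open Scope complex_scope.

Lemma cexpD z w : cexp (z + w) = cexp z * cexp w.
Proof.
case: z w => [a b] [c d]; rewrite /cexp /= expRD cosD sinD.
by apply/eqP; rewrite eq_complex /=; apply/andP; split; apply/eqP; ring.
Qed.

Lemma cexp0 : cexp 0 = 1 :> R[i].
Proof. by rewrite /cexp /= expR0 cos0 sin0 mul1r. Qed.

Lemma cexpMn z n : cexp (z *+ n) = cexp z ^+ n.
Proof. by elim: n => [|n IH]; [rewrite mulr0n cexp0|rewrite mulrS cexpD IH exprS]. Qed.

Lemma norm_complex_le (a b : R) : `|a +i* b| <= (`|a| + `|b|)%:C.
Proof.
rewrite normc_def /= lecR -[leRHS]ger0_norm ?addr_ge0// -sqrtr_sqr ler_wsqrtr//.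
rewrite sqrrD !real_normK ?num_real// addrAC lerDl.
by rewrite mulrn_wge0// mulr_ge0.
Qed.

Lemma norm_Re_le z (c : R) : `|z| <= c%:C -> `|complex.Re z| <= c.
Proof.
case: z => a b; rewrite normc_def /= lecR; apply: le_trans.
by rewrite -sqrtr_sqr ler_wsqrtr// lerDl sqr_ge0.
Qed.

Lemma norm_Im_le z (c : R) : `|z| <= c%:C -> `|complex.Im z| <= c.
Proof.
case: z => a b; rewrite normc_def /= lecR; apply: le_trans.
by rewrite -sqrtr_sqr ler_wsqrtr// lerDr sqr_ge0.
Qed.

Lemma norm_phase (b : R) : `|cos b +i* sin b| = 1.
Proof. by rewrite normc_def /= cos2Dsin2 sqrtr1. Qed.

Lemma norm_cexp z : `|cexp z| = (expR (complex.Re z))%:C.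
Proof. by rewrite /cexp normrM norm_phase mulr1 normc_def /= expr0n addr0 sqrtr_sqr ger0_norm// expR_ge0. Qed.

Lemma norm_cexp_le1 z : complex.Re z <= 0 -> `|cexp z| <= 1.
Proof. by move=> z0; rewrite norm_cexp lecR -expR0 ler_expR. Qed.

Lemma norm_subX (D : numDomainType) (x y : D) n : `|x| <= 1 -> `|y| <= 1 ->
  `|x ^+ n - y ^+ n| <= `|x - y| *+ n.
Proof.
move=> x1 y1; elim: n => [|n IH]; first by rewrite !expr0 subrr normr0.
have -> : x ^+ n.+1 - y ^+ n.+1 = x * (x ^+ n - y ^+ n) + (x - y) * y ^+ n.
  by rewrite !exprS mulrBr mulrBl addrA subrK.
rewrite mulrS addrC (le_trans (ler_normD _ _))// lerD//.
  by rewrite normrM (le_trans _ IH)// ler_piMl.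
by rewrite normrM ler_piMr// normrX exprn_ile1.
Qed.

Lemma expRB1_sqr (x : R) : x <= 0 -> `|expR x - 1 - x| <= x ^+ 2 / 2.
Proof.
move=> x0; rewrite ger0_norm; last by rewrite subr_ge0 lerBrDl expR_ge1Dx.
pose f (y : R) := y ^+ 2 / 2 - (expR (- y) - 1 - - y).
have : 0 <= f (- x).
  apply: (@ge0_of_derive_ge0 _ f (fun y => y + expR (- y) - 1)) => //.
  - move=> y; apply: is_derive_eq; rewrite /GRing.scale/=; lra.
  - by move=> y y0; have := expR_ge1Dx (- y); lra.
  - by rewrite /f oppr0 expR0 expr0n/=; lra.
  - by rewrite oppr_ge0.
by rewrite /f opprK sqrrN subr_ge0.
Qed.

Lemma expRB1_le (x : R) : x <= 0 -> `|expR x - 1| <= `|x|.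
Proof.
move=> x0; rewrite ler0_norm; last by rewrite subr_le0 -expR0 ler_expR.
by rewrite ler0_norm// lerN2 lerBrDl expR_ge1Dx.
Qed.

(** A nonpositive real part keeps [expR a] at most 1, so the remainder is quadratic with no
    exponential factor. *)
Lemma cexp_taylor z : complex.Re z <= 0 ->
  `|cexp z - 1 - z| <= ((`|complex.Re z| + `|complex.Im z|) ^+ 2)%:C.
Proof.
case: z => a b /= a0; rewrite /cexp /=.
have -> : (expR a)%:C * (cos b +i* sin b) - 1 - (a +i* b) =
   (expR a * cos b - 1 - a) +i* (expR a * sin b - b).
  by apply/eqP; rewrite eq_complex /=; apply/andP; split; apply/eqP; ring.
apply: (le_trans (norm_complex_le _ _)); rewrite lecR.
have e1 : 0 <= expR a <= 1 by rewrite expR_ge0 -expR0 ler_expR.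
have /andP[ea0 ea1] := e1.
have -> : expR a * cos b - 1 - a = expR a * (cos b - 1) + (expR a - 1 - a) by ring.
have -> : expR a * sin b - b = expR a * (sin b - b) + b * (expR a - 1) by ring.
have H1 : `|expR a * (cos b - 1) + (expR a - 1 - a)| <= b ^+ 2 / 2 + a ^+ 2 / 2.
  apply: (le_trans (ler_normD _ _)); apply: lerD; last exact: expRB1_sqr.
  by rewrite normrM (ger0_norm ea0) (le_trans _ (cosB1_le_sqr b))// ler_piMl.
have H2 : `|expR a * (sin b - b) + b * (expR a - 1)| <= b ^+ 2 / 2 + `|b| * `|a|.
  apply: (le_trans (ler_normD _ _)); apply: lerD.
    by rewrite normrM (ger0_norm ea0) (le_trans _ (sinB_le_sqr b))// ler_piMl.
  by rewrite normrM ler_wpM2l// expRB1_le.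
apply: (le_trans (lerD H1 H2)).
rewrite sqrrD !real_normK ?num_real//.
have : 0 <= a ^+ 2 by exact: sqr_ge0.
have : 0 <= `|b| * `|a| by rewrite mulr_ge0.
by rewrite (mulrC `|a|); lra.
Qed.

(** Both [1 + w] and [cexp w] lie in the unit disc, so the m-th power multiplies their quadratic
    distance by at most [m]. This is the Poisson approximation of the binomial at the level of
    characteristic functions. *)
Lemma cexp_power_approx w m : complex.Re w <= 0 -> `|1 + w| <= 1 ->
  `|(1 + w) ^+ m - cexp (w *+ m)| <= (m%:R * (`|complex.Re w| + `|complex.Im w|) ^+ 2)%:C.
Proof.
move=> w0 w1; rewrite cexpMn.
apply: (le_trans (norm_subX _ w1 (norm_cexp_le1 w0))).
have := cexp_taylor w0; rewrite -normrN => H.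
have -> : (m%:R * (`|complex.Re w| + `|complex.Im w|) ^+ 2)%:C =
   ((`|complex.Re w| + `|complex.Im w|) ^+ 2)%:C *+ m.
  by rewrite mulr_natl raddfMn.
rewrite lerMn2r; apply/orP; right; apply: le_trans H.
by rewrite opprB opprB addrA (addrC w).
Qed.

(** Turns a linear bound on the exponent into the linear bound on 1 - Re phi that tightness asks
    for. *)
Lemma cexp_Re_bound z : complex.Re z <= 0 ->
  1 - complex.Re (cexp z) <= `|complex.Re z| + `|complex.Im z|.
Proof.
case: z => a b /= a0; rewrite mul0r subr0.
have ea0 : 0 <= expR a by exact: expR_ge0.
have ea1 : expR a <= 1 by rewrite -expR0 ler_expR.
have -> : 1 - expR a * cos b = - (expR a - 1) + - (expR a * (cos b - 1)) by ring.
apply: lerD; first by rewrite (le_trans (ler_norm _))// normrN expRB1_le.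
rewrite (le_trans (ler_norm _))// normrN normrM (ger0_norm ea0).
by rewrite (le_trans _ (norm_cosB1_le b))// ler_piMl.
Qed.

End complex_exponential.

(** * Mixtures of a point mass at 0 and a restricted measure *)

Section mixture.
Context {R : realType} (nu : {measure set (measurableTypeR R) -> \bar R}).
Variables (A : set (measurableTypeR R)) (mA : measurable A) (w : R).
Hypotheses (nuA : (nu A < +oo)%E) (w0 : 0 <= w) (wA : w * fine (nu A) <= 1).

Let nuA_fin : nu A \is a fin_num.
Proof. by rewrite ge0_fin_numE. Qed.

Let v0 : 0 <= 1 - w * fine (nu A). Proof. by rewrite subr_ge0. Qed.

Let q := measure_add (mscale (NngNum v0) \d_(0 : measurableTypeR R))
  (mscale (NngNum w0) (mrestr nu mA)).
#[local] HB.instance Definition _ := Measure.on q.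

Let qT : q setT = 1%E.
Proof.
rewrite /q measure_addE.
rewrite -[LHS]/((1 - w * fine (nu A))%:E * \d_(0%R : measurableTypeR R) setT + w%:E * nu (setT `&` A))%E.
rewrite diracT setTI mule1.
by rewrite -(fineK nuA_fin) -EFinM -EFinD subrK.
Qed.

#[local] HB.instance Definition _ := Measure_isProbability.Build _ _ _ q qT.

Let integral_mrestr (f : measurableTypeR R -> \bar R) : measurable_fun setT f ->
  (forall x, (0 <= f x)%E) ->
  (\int[mrestr nu mA]_x f x = \int[nu]_(x in A) f x)%E.
Proof.
move=> mf f0.
rewrite (@ge0_negligible_integral _ _ _ (mrestr nu mA) setT (~` A)) //; last 2 first.
- exact: measurableC.
- by rewrite -[LHS]/(nu (~` A `&` A)) setICl measure0.
rewrite setDE setTI setCK.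
by apply: eq_measure_integral => B mB BA; rewrite -[LHS]/(nu (B `&` A)) setIidl.
Qed.

Let cstA (c : R) : nu.-integrable A (EFin \o cst c).
Proof.
apply/integrableP; split; first exact/measurable_EFinP.
have -> : (fun x => `|(EFin \o cst c) x|%E) = (cst `|c|%:E : measurableTypeR R -> \bar R) by [].
by rewrite integral_cst// lte_mul_pinfty// lee_fin.
Qed.

Let ge0_integral_q (f : measurableTypeR R -> R) M : measurable_fun setT f ->
  (forall x, 0 <= f x <= M) ->
  Rintegral q setT f = (1 - w * fine (nu A)) * f 0 + w * Rintegral nu A f.
Proof.
move=> mf fM.
have f0 x : (0 <= (f x)%:E)%E by rewrite lee_fin; have /andP[] := fM x.
have mf' : measurable_fun setT (EFin \o f) by exact/measurable_EFinP.
have intA : nu.-integrable A (EFin \o f).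
  apply: (@le_integrable _ _ _ nu A mA _ (EFin \o cst M)).
  - by apply: measurable_funS mf'.
  - move=> x _ /=; rewrite lee_fin; have /andP[h1 h2] := fM x.
    by rewrite ger0_norm// (le_trans h2)// ler_norm.
  - exact: cstA.
rewrite /Rintegral /q ge0_integral_measure_add// !ge0_integral_mscale//.
rewrite integral_mrestr// integral_dirac//= diracT mul1e.
by rewrite -(fineK (integrable_fin_num mA intA)) -!EFinM -EFinD /=.
Qed.

(** The mass left at 0 turns [f u] into the increment [f u - f 0]. For cosines and sines this gives
    1 plus [w] times the truncated Levy integral before compensation. *)
Lemma mixture_probability : exists q : probability (measurableTypeR R) R,
  forall (f : measurableTypeR R -> R) M, measurable_fun setT f -> (forall x, `|f x| <= M) ->
  Rintegral q setT f = f 0 + w * Rintegral nu setT (fun u => \1_A u * (f u - f 0)).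
Proof.
exists q => f M mf fM.
(* Integrals against the sum of two measures are split for nonnegative functions; the shift by [M]
   reduces to them and cancels at the end because [q] has mass 1. *)
have fb x : 0 <= f x + M <= 2 * M by have := fM x; rewrite ler_norml => /andP[]; lra.
have mfM : measurable_fun setT (fun x => f x + M) by exact: measurable_funD.
have := ge0_integral_q mfM fb.
have ifq : q.-integrable setT (EFin \o f) by exact: integrable_bounded mf fM.
have E1 : Rintegral q setT (fun x => f x + M) = Rintegral q setT f + M.
  rewrite RintegralD//.
    by rewrite Rintegral_cst//= probability_setT mulr1.
  exact: finite_measure_integrable_cst.
have intA : nu.-integrable A (EFin \o f).
  apply: (@le_integrable _ _ _ nu A mA _ (EFin \o cst M)) => //.
  - by apply/measurable_EFinP; apply: measurable_funS mf.
  - by move=> x _ /=; rewrite lee_fin (le_trans (fM x))// ler_norm.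
have E2 : Rintegral nu A (fun x => f x + M) = Rintegral nu A f + M * fine (nu A).
  rewrite RintegralD//; last exact: cstA.
  by rewrite Rintegral_cst.
have E3 : Rintegral nu setT (fun u => \1_A u * (f u - f 0)) = Rintegral nu A f - f 0 * fine (nu A).
  rewrite -(Rintegral_cst nu mA) -RintegralB//; last exact: cstA.
  rewrite [RHS]Rintegral_mkcond; apply: eq_Rintegral => x _.
  by rewrite patchE indicE; case: (x \in A); rewrite ?mul1r ?mul0r.
rewrite E1 E2 E3 => H.
apply: (@addIr _ M); rewrite H; ring.
Qed.

End mixture.

(** * Domination of integrals against the Levy measure *)

Section levy_measure.
Context {R : realType} (nu : {measure set (measurableTypeR R) -> \bar R}).
Hypothesis nu_levy : (\int[nu]_u (Num.min 1 ((u : R) ^+ 2))%R%:E < +oo)%E.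
Hypothesis nu_first_moment :
  (\int[nu]_(u in [set u : R | (1 < `|u|)%R]) `|u : R|%R%:E < +oo)%E.

(* Dominates, up to constants, every integrand against [nu] below. *)
Definition levy_weight (u : R) : R := Num.min 1 (u ^+ 2) + `|u| * (1 < `|u|)%R%:R.
Local Notation H := levy_weight.

Lemma levy_weight_small u : `|u| <= 1 -> H u = u ^+ 2.
Proof.
move=> u1; rewrite /H ltNge u1 mulr0 addr0 min_r//.
by rewrite -real_normK ?num_real// exprn_ile1.
Qed.

Lemma levy_weight_big u : 1 < `|u| -> H u = 1 + `|u|.
Proof.
move=> u1; rewrite /H u1 mulr1 min_l//.
by rewrite -[X in _ <= X]real_normK ?num_real// exprn_ege1// ltW.
Qed.

Lemma levy_weight_ge0 u : 0 <= H u.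
Proof.
have [u1|u1] := leP `|u| 1; first by rewrite levy_weight_small// sqr_ge0.
by rewrite levy_weight_big// addr_ge0.
Qed.

Let measurable_norm_gt1 : measurable [set u : measurableTypeR R | (1 < `|u|)%R].
Proof.
have -> : [set u : measurableTypeR R | (1 < `|u|)%R] = ~` [set u : measurableTypeR R | (`|u| <= 1)%R].
  by apply/seteqP; split=> u /=; rewrite ltNge => /negP.
apply: measurableC; rewrite -[X in measurable X]setTI.
by apply: measurable_fun_le => //; exact: measurableT_comp.
Qed.

Lemma measurable_norm_le1 :
  measurable_fun setT ((fun u => (`|u| <= 1)%R%:R) : measurableTypeR R -> R).
Proof.
have -> : (fun u : R => (`|u| <= 1)%R%:R) = \1_(~` [set u : measurableTypeR R | (1 < `|u|)%R]) :> (measurableTypeR R -> R).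
  apply/funext => u; rewrite indicE; have [u1|u1] := leP `|u| 1.
    by rewrite mem_set//=; apply/negP; rewrite -leNgt.
  by rewrite memNset//=; apply.
by apply: measurable_indic; exact: measurableC.
Qed.

Let weight_big_indic : (fun u : R => `|u| * (1 < `|u|)%R%:R) =
  (fun u : measurableTypeR R => `|u| * \1_[set u : measurableTypeR R | (1 < `|u|)%R] u).
Proof.
apply/funext => u; rewrite indicE; have [u1|u1] := ltP 1 `|u|; first by rewrite mem_set.
by rewrite memNset//=; apply/negP; rewrite -leNgt.
Qed.

Lemma integrable_levy_weight : nu.-integrable setT (EFin \o H).
Proof.
have m1 : measurable_fun setT ((fun u => Num.min 1 (u ^+ 2)) : measurableTypeR R -> R).
  by apply: measurable_minr => //; exact: measurable_funX.
have m2 : measurable_fun setT ((fun u => `|u|) : measurableTypeR R -> R).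
  exact: measurableT_comp.
have I1 : nu.-integrable setT (EFin \o (fun u : R => Num.min 1 (u ^+ 2))).
  apply/integrableP; split; first exact/measurable_EFinP.
  apply: le_lt_trans nu_levy; rewrite le_eqVlt; apply/orP; left; apply/eqP.
  apply: eq_integral => u _ /=; rewrite ger0_norm// le_min ler01 sqr_ge0//.
have I2 : nu.-integrable setT (EFin \o (fun u : R => `|u| * (1 < `|u|)%R%:R)).
  have : nu.-integrable [set u : measurableTypeR R | (1 < `|u|)%R] (EFin \o (fun u : R => `|u|)).
    apply/integrableP; split.
      by apply: measurable_funTS; exact/measurable_EFinP.
    apply: le_lt_trans nu_first_moment; rewrite le_eqVlt; apply/orP; left; apply/eqP.
    by apply: eq_integral => u _ /=; rewrite normr_id.
  rewrite integrable_mkcond//; apply: eq_integrable => // u _ /=.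
  rewrite [in RHS](congr1 (@^~ u) weight_big_indic : `|u| * (1 < `|u|)%R%:R = _) patchE indicE.
  by case: (u \in _); rewrite ?mulr1 ?mulr0.
by have := integrableD measurableT I1 I2; apply: eq_integrable.
Qed.

Definition levy_mass : R := Rintegral nu setT H.

Lemma levy_integrable (f : measurableTypeR R -> R) C : measurable_fun setT f ->
  (forall u, `|f u| <= C * H u) -> nu.-integrable setT (EFin \o f).
Proof.
move=> mf fH; apply: (integrable_le mf _ fH).
by have := integrableZl measurableT C integrable_levy_weight; apply: eq_integrable.
Qed.

Lemma levy_Rintegral_le (f : measurableTypeR R -> R) C : measurable_fun setT f ->
  (forall u, `|f u| <= C * H u) -> `|Rintegral nu setT f| <= C * levy_mass.
Proof.
move=> mf fH; have If := levy_integrable mf fH.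
apply: (le_trans (le_normr_Rintegral measurableT If)).
have IH : nu.-integrable setT (EFin \o (fun u : R => C * H u)).
  by have := integrableZl measurableT C integrable_levy_weight; apply: eq_integrable.
rewrite -RintegralZl//; last exact: integrable_levy_weight.
by apply: le_Rintegral => //; exact: integrable_norm.
Qed.

Lemma levy_mass_ge0 : 0 <= levy_mass.
Proof. by apply: Rintegral_ge0 => u _; exact: levy_weight_ge0. Qed.

(** Second order for small jumps, first order for large ones. The factor is at most 2 |t| for |t| <=
    1, which tightness uses. *)
Lemma levy_cos_bound t u : `|cos (t * u) - 1| <= (t ^+ 2 + `|t|) * H u.
Proof.
have [u1|u1] := leP `|u| 1.
  rewrite levy_weight_small// (le_trans (cosB1_le_sqr _))// exprMn mulrDl.
  have : 0 <= t ^+ 2 * u ^+ 2 by rewrite mulr_ge0// sqr_ge0.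
  have : 0 <= `|t| * u ^+ 2 by rewrite mulr_ge0// sqr_ge0.
  lra.
rewrite levy_weight_big// (le_trans (norm_cosB1_le _))// normrM.
have := sqr_ge0 t; have := normr_ge0 t; have := normr_ge0 u; nra.
Qed.

Lemma levy_sin_bound t u :
  `|sin (t * u) - t * u * (`|u| <= 1)%R%:R| <= (t ^+ 2 + `|t|) * H u.
Proof.
have [u1|u1] := leP `|u| 1.
  rewrite mulr1 levy_weight_small// (le_trans (sinB_le_sqr _))// exprMn mulrDl.
  have : 0 <= t ^+ 2 * u ^+ 2 by rewrite mulr_ge0// sqr_ge0.
  have : 0 <= `|t| * u ^+ 2 by rewrite mulr_ge0// sqr_ge0.
  lra.
rewrite mulr0 subr0 levy_weight_big// (le_trans (norm_sin_le _))// normrM.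
have := sqr_ge0 t; have := normr_ge0 t; have := normr_ge0 u; nra.
Qed.

Lemma measurable_levy_cos t : measurable_fun setT ((fun u => cos (t * u) - 1) : measurableTypeR R -> R).
Proof. by apply: measurable_funB => //; exact: measurable_cosM. Qed.

Lemma measurable_levy_sin t :
  measurable_fun setT ((fun u => sin (t * u) - t * u * (`|u| <= 1)%R%:R) : measurableTypeR R -> R).
Proof.
apply: measurable_funB; first exact: measurable_sinM.
by apply: measurable_funM; [exact: measurable_funM|exact: measurable_norm_le1].
Qed.

Definition psi_re t := Rintegral nu setT (fun u => cos (t * u) - 1).
Definition psi_im b t := t * b + Rintegral nu setT (fun u => sin (t * u) - t * u * (`|u| <= 1)%R%:R).


(** * A law with characteristic function exp (c psi), applied with c = 1 / n *)

Section existence.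
Variables (b c : R).
Hypothesis c0 : 0 <= c.
Local Notation I := levy_mass.

Let A k : set (measurableTypeR R) := [set u : measurableTypeR R | k.+1%:R^-1 < `|u|].

Let mA k : measurable (A k).
Proof.
have -> : A k = ~` [set u : measurableTypeR R | (`|u| <= k.+1%:R^-1)%R].
  by apply/seteqP; split=> u /=; rewrite /A/= ltNge => /negP.
apply: measurableC; rewrite -[X in measurable X]setTI.
by apply: measurable_fun_le => //; exact: measurableT_comp.
Qed.

Let chi k : measurableTypeR R -> R := \1_(A k).

Let chiE k u : chi k u = (k.+1%:R^-1 < `|u|)%R%:R.
Proof.
rewrite /chi indicE; have [h|h] := ltP k.+1%:R^-1 `|u|; first by rewrite mem_set.
by rewrite memNset//= /A/=; apply/negP; rewrite -leNgt.
Qed.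

Let mchi k : measurable_fun setT (chi k). Proof. exact: measurable_indic. Qed.

Let chi01 k u : 0 <= chi k u <= 1.
Proof. by rewrite chiE; case: (_ < _); rewrite ?lexx ?ler01. Qed.

Let chi_le k (f : R -> R) u C : `|f u| <= C -> `|chi k u * f u| <= C.
Proof.
by move=> fC; have /andP[h0 h1] := chi01 k u; rewrite normrM (ger0_norm h0) (le_trans _ fC)// ler_piMl.
Qed.

(** On [A k] one has 1 < (k + 1) |u|, so each power of |u| missing near 0 costs a factor k + 1; the
    next bound pays for two powers. *)
Let chi_abs k u : chi k u * `|u| <= k.+1%:R * H u.
Proof.
have k1 : 1 <= k.+1%:R :> R by rewrite ler1n.
rewrite chiE; have [h|h] := ltP k.+1%:R^-1 `|u|; last by rewrite mul0r mulr_ge0// levy_weight_ge0.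
rewrite mul1r; have [u1|u1] := leP `|u| 1.
  rewrite levy_weight_small// -(real_normK (num_real u)) expr2 mulrA ler_peMl//.
  by rewrite mulrC -ler_pdivrMr// div1r ltW.
by rewrite levy_weight_big//; have := normr_ge0 u; nra.
Qed.

Let chi_le_weight k u : chi k u <= k.+1%:R ^+ 2 * H u.
Proof.
have k1 : 1 <= k.+1%:R :> R by rewrite ler1n.
rewrite chiE; have [h|h] := ltP k.+1%:R^-1 `|u|; last by rewrite mulr_ge0 ?levy_weight_ge0 ?sqr_ge0.
have [u1|u1] := leP `|u| 1.
  rewrite levy_weight_small// -(real_normK (num_real u)) -exprMn exprn_ege1//.
  by rewrite mulrC -ler_pdivrMr// div1r ltW.
rewrite levy_weight_big//; have := normr_ge0 u.
have : 1 <= k.+1%:R ^+ 2 :> R by rewrite exprn_ege1.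
rewrite -[X in _ -> _ -> X <= _]/(1 : R); nra.
Qed.

Let chi_integrable k : nu.-integrable setT (EFin \o chi k).
Proof.
apply: (@levy_integrable _ (k.+1%:R ^+ 2)) => // u.
by have /andP[h0 _] := chi01 k u; rewrite ger0_norm// chi_le_weight.
Qed.

Let nuA_E k : (nu (A k) = \int[nu]_u (chi k u)%:E)%E.
Proof. by rewrite integral_indic// setIT. Qed.

Let nuA_fin k : (nu (A k) < +oo)%E.
Proof. by rewrite nuA_E; apply: integrable_lty => //; exact: chi_integrable. Qed.

Let nuA_le k : fine (nu (A k)) <= k.+1%:R ^+ 2 * I.
Proof.
rewrite nuA_E -[leLHS]/(Rintegral nu setT (chi k)) (le_trans (ler_norm _))//.
apply: levy_Rintegral_le => // u.
by have /andP[h0 _] := chi01 k u; rewrite ger0_norm// chi_le_weight.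
Qed.

Let N0 := (Num.truncn (c * I)).+1.
Let cI_N0 : c * I <= N0%:R. Proof. by rewrite ltW// truncnS_gt. Qed.
(** Two constraints meet here. The weight [w k * nu (A k)], at most c (k + 1) ^ 2 I / m, must not
    exceed 1, and the error of the power approximation, of order (k + 1) ^ 2 / m, must vanish. [N0]
    serves the first, the cube the second. *)
Let m k := (k.+1 ^ 3 * N0)%N.
Let mE k : (m k)%:R = k.+1%:R ^+ 3 * N0%:R :> R. Proof. by rewrite natrM natrX. Qed.
Let m_gt0 k : 0 < (m k)%:R :> R. Proof. by rewrite ltr0n muln_gt0 expn_gt0. Qed.
Let w k := c / (m k)%:R.
Let w0 k : 0 <= w k. Proof. by rewrite divr_ge0// ltW. Qed.

Let wA k : w k * fine (nu (A k)) <= 1.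
Proof.
apply: (le_trans (ler_wpM2l (w0 k) (nuA_le k))).
have k1 : 1 <= k.+1%:R :> R by rewrite ler1n.
have -> : w k * (k.+1%:R ^+ 2 * I) = k.+1%:R ^+ 2 * (c * I) / (m k)%:R by rewrite /w; ring.
rewrite ler_pdivrMr// mul1r mE; apply: (@le_trans _ _ (k.+1%:R ^+ 2 * N0%:R)).
  by rewrite ler_wpM2l ?sqr_ge0.
have -> : k.+1%:R ^+ 3 * N0%:R = k.+1%:R * (k.+1%:R ^+ 2 * N0%:R) :> R by ring.
by rewrite ler_peMl// mulr_ge0 ?sqr_ge0.
Qed.

Let q k := projT1 (cid (mixture_probability (mA k) (nuA_fin k) (w0 k) (wA k))).

Let qE k (f : measurableTypeR R -> R) M : measurable_fun setT f -> (forall x, `|f x| <= M) ->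
  Rintegral (q k) setT f = f 0 + w k * Rintegral nu setT (fun u => chi k u * (f u - f 0)).
Proof. exact: (projT2 (cid (mixture_probability (mA k) (nuA_fin k) (w0 k) (wA k)))). Qed.

Let Zre k t := Rintegral nu setT (fun u => chi k u * (cos (t * u) - 1)).
Let Zim k t := Rintegral nu setT (fun u => chi k u * sin (t * u)).

Let Zre_bound k t : `|Zre k t| <= `|t| * k.+1%:R * I.
Proof.
apply: levy_Rintegral_le => [|u].
  by apply: measurable_funM => //; exact: measurable_levy_cos.
have /andP[h0 h1] := chi01 k u.
rewrite normrM (ger0_norm h0) -mulrA (le_trans (ler_wpM2l h0 (norm_cosB1_le _)))//.
by rewrite normrM mulrCA ler_wpM2l// chi_abs.
Qed.

Let Zim_bound k t : `|Zim k t| <= `|t| * k.+1%:R * I.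
Proof.
apply: levy_Rintegral_le => [|u].
  by apply: measurable_funM => //; exact: measurable_sinM.
have /andP[h0 h1] := chi01 k u.
rewrite normrM (ger0_norm h0) -mulrA (le_trans (ler_wpM2l h0 (norm_sin_le _)))//.
by rewrite normrM mulrCA ler_wpM2l// chi_abs.
Qed.

Let Zre_le0 k t : Zre k t <= 0.
Proof.
rewrite -oppr_ge0 /Zre -[X in 0 <= - X]mul1r -mulNr -RintegralZl//; last first.
  apply: (@levy_integrable _ (t ^+ 2 + `|t|)).
    by apply: measurable_funM => //; exact: measurable_levy_cos.
  by move=> u; apply: (@chi_le k (fun u => cos (t * u) - 1)); exact: levy_cos_bound.
apply: Rintegral_ge0 => u _; have /andP[h0 _] := chi01 k u.
by rewrite mulN1r -mulrN mulr_ge0// oppr_ge0 subr_le0 cos_le1.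
Qed.

Let W k t : R[i] := ((w k * Zre k t) +i* (w k * Zim k t))%C.

Let cf_q k t : cf (q k) t = 1 + W k t.
Proof.
rewrite /cf /icos /isin.
rewrite (@qE k _ 1); [|exact: measurable_cosM|by move=> x; exact: cos_max].
rewrite (@qE k _ 1); [|exact: measurable_sinM|by move=> x; exact: sin_max].
rewrite mulr0 cos0 sin0; under [X in (_ +i* (_ + _ * X))%C]eq_Rintegral do rewrite subr0.
by apply/eqP; rewrite eq_complex /= !eqxx.
Qed.

Let norm_cf_q k t : `|1 + W k t| <= 1.
Proof.
rewrite -cf_q normc_def /cf lecR -[leRHS]sqrtr1 ler_wsqrtr//; exact: norm_cf_le1.
Qed.

(** The truncated compensator. It may diverge as k grows, since nu need not integrate |u| near 0;
    only its combination with [Zim] has a limit. *)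
Let small k := Rintegral nu setT (fun u => chi k u * (u * (`|u| <= 1)%R%:R)).
Let shift k := c * (b - small k).
(* The law of a drift plus [m k] independent steps, each being [0] with probability
   [1 - w k * nu (A k)] and distributed as [w k * nu] on [A k] otherwise. *)
Let rho k := convolution (convolution_power (q k) (m k)) \d_(shift k : measurableTypeR R).

Let Psi k t : R[i] := ((c * Zre k t) +i* (c * Zim k t + t * shift k))%C.

Let WmE k t : W k t *+ m k = ((c * Zre k t) +i* (c * Zim k t))%C.
Proof.
have E (x y : R) n : (x +i* y)%C *+ n = ((x *+ n) +i* (y *+ n))%C.
  by elim: n => [|n IH]; rewrite ?mulr0n// !mulrS IH.
have mN0 : (m k)%:R != 0 :> R by rewrite gt_eqF.
have F (x : R) : w k * x *+ m k = c * x.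
  by rewrite -mulr_natl /w mulrA (mulrCA _ c) mulfV// mulr1.
by rewrite /W E !F.
Qed.

(** The drift is a factor of modulus 1 and drops out. The remaining error is m |W| ^ 2 with |W| of
    order (k + 1) / m. *)
Let cf_rho_approx k t :
  `|cf (rho k) t - cexp (Psi k t)| <= (4 * c ^+ 2 * t ^+ 2 * I ^+ 2 / k.+1%:R)%:C%C.
Proof.
rewrite cf_convolution cf_dirac cf_convolution_power cf_q.
have -> : Psi k t = W k t *+ m k + (0 +i* (t * shift k))%C.
  by rewrite WmE /Psi; apply/eqP; rewrite eq_complex /= addr0 !eqxx.
have phase : cexp (0 +i* (t * shift k))%C = (cos (t * shift k) +i* sin (t * shift k))%C.
  by rewrite /cexp /= expR0 mul1r.
rewrite cexpD phase -mulrBl normrM norm_phase mulr1.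
have Wre0 : complex.Re (W k t) <= 0 by exact: mulr_ge0_le0 (w0 k) (Zre_le0 k t).
apply: (le_trans (cexp_power_approx _ Wre0 (norm_cf_q k t))); rewrite lecR /=.
rewrite (normrM (w k) (Zre k t)) (normrM (w k) (Zim k t)) (ger0_norm (w0 k)) -mulrDr exprMn.
have Zb : (`|Zre k t| + `|Zim k t|) ^+ 2 <= (2 * (`|t| * k.+1%:R * I)) ^+ 2.
  rewrite lerXn2r ?nnegrE ?addr_ge0// ?mulr_ge0// ?levy_mass_ge0//.
  by have := Zre_bound k t; have := Zim_bound k t; lra.
have -> : (m k)%:R * (w k ^+ 2 * (`|Zre k t| + `|Zim k t|) ^+ 2) =
  c ^+ 2 / (m k)%:R * (`|Zre k t| + `|Zim k t|) ^+ 2.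
  by rewrite /w; field; rewrite gt_eqF.
have cm0 : 0 <= c ^+ 2 / (m k)%:R by rewrite divr_ge0 ?sqr_ge0// ltW.
apply: (le_trans (ler_wpM2l cm0 Zb)).
have k0 : 0 < k.+1%:R :> R by rewrite ltr0n.
have N00 : 0 < N0%:R :> R by rewrite ltr0n.
have -> : c ^+ 2 / (m k)%:R * (2 * (`|t| * k.+1%:R * I)) ^+ 2 =
   4 * c ^+ 2 * `|t| ^+ 2 * I ^+ 2 / k.+1%:R * N0%:R^-1.
  by rewrite mE; field; rewrite !gt_eqF.
rewrite real_normK ?num_real// ler_piMr//.
  by rewrite divr_ge0// mulr_ge0 ?sqr_ge0// mulr_ge0 ?sqr_ge0// mulr_ge0 ?sqr_ge0.
by rewrite invf_le1// ler1n.
Qed.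

(** Moving the compensator back under the integral makes the integrand of second order at 0, hence
    dominated uniformly in [k]. *)
Let Psi_im_E k t : c * Zim k t + t * shift k =
  c * (t * b + Rintegral nu setT (fun u => chi k u * (sin (t * u) - t * u * (`|u| <= 1)%R%:R))).
Proof.
have Is : nu.-integrable setT (EFin \o (fun u => chi k u * sin (t * u))).
  apply: (@levy_integrable _ (`|t| * k.+1%:R)) => [|u].
    by apply: measurable_funM => //; exact: measurable_sinM.
  have /andP[h0 h1] := chi01 k u.
  rewrite normrM (ger0_norm h0) -mulrA (le_trans (ler_wpM2l h0 (norm_sin_le _)))//.
  by rewrite normrM mulrCA ler_wpM2l// chi_abs.
have Iu : nu.-integrable setT (EFin \o (fun u => chi k u * (u * (`|u| <= 1)%R%:R))).
  apply: (@levy_integrable _ (k.+1%:R)) => [|u].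
    by apply: measurable_funM => //; apply: measurable_funM => //; exact: measurable_norm_le1.
  have /andP[h0 h1] := chi01 k u.
  apply: le_trans (chi_abs k u); rewrite normrM (ger0_norm h0) ler_wpM2l// normrM ler_piMr//.
  by case: (`|u| <= 1); rewrite ?normr1 ?normr0.
have -> : (fun u => chi k u * (sin (t * u) - t * u * (`|u| <= 1)%R%:R)) =
  (fun u => chi k u * sin (t * u) - t * (chi k u * (u * (`|u| <= 1)%R%:R))).
  by apply/funext => u; ring.
rewrite RintegralB//; last by have := integrableZl measurableT t Iu; apply: eq_integrable.
by rewrite RintegralZl// /shift /small -/(Zim k t); ring.
Qed.

Let Psi_re_cvg t : c * Zre k t @[k --> \oo] --> c * psi_re t.
Proof.
apply: cvgMr.
apply: (@Rintegral_dominated_cvg _ _ _ nu _ _ (fun u => (t ^+ 2 + `|t|) * H u)).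
- by move=> k; apply: measurable_funM => //; exact: measurable_levy_cos.
- by have := integrableZl measurableT (t ^+ 2 + `|t|) integrable_levy_weight; apply: eq_integrable.
- by move=> k u; apply: (@chi_le k (fun u => cos (t * u) - 1)); exact: levy_cos_bound.
(* The point 0 lies in no [A k], but the integrand vanishes there; every other point lies in [A k]
   for large [k]. *)
- move=> u; have [->|u0] := eqVneq u 0.
    by under eq_fun do rewrite mulr0 cos0 subrr mulr0; rewrite mulr0 cos0 subrr; exact: cvg_cst.
  apply: cvg_near_cst; near=> k; rewrite chiE.
  have -> : (k.+1%:R^-1 < `|u|)%R; last by rewrite mul1r.
  by near: k; rewrite -normr_gt0 in u0; exact: (near_infty_natSinv_lt (PosNum u0)).
Unshelve. all: by end_near. Qed.

Let Psi_im_cvg t : c * Zim k t + t * shift k @[k --> \oo] --> c * psi_im b t.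
Proof.
under eq_fun do rewrite Psi_im_E.
apply: cvgMr; apply: cvgD; first exact: cvg_cst.
apply: (@Rintegral_dominated_cvg _ _ _ nu _ _ (fun u => (t ^+ 2 + `|t|) * H u)).
- by move=> k; apply: measurable_funM => //; exact: measurable_levy_sin.
- by have := integrableZl measurableT (t ^+ 2 + `|t|) integrable_levy_weight; apply: eq_integrable.
- by move=> k u; apply: (@chi_le k (fun u => sin (t * u) - t * u * (`|u| <= 1)%R%:R)); exact: levy_sin_bound.
- move=> u; have [->|u0] := eqVneq u 0.
    under eq_fun do rewrite mulr0 sin0 mul0r subrr mulr0.
    by rewrite mulr0 sin0 mul0r subrr; exact: cvg_cst.
  apply: cvg_near_cst; near=> k; rewrite chiE.
  have -> : (k.+1%:R^-1 < `|u|)%R; last by rewrite mul1r.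
  by near: k; rewrite -normr_gt0 in u0; exact: (near_infty_natSinv_lt (PosNum u0)).
Unshelve. all: by end_near. Qed.

Let error_cvg t : 4 * c ^+ 2 * t ^+ 2 * I ^+ 2 / k.+1%:R @[k --> \oo] --> (0 : R).
Proof.
rewrite -[X in _ --> X](mulr0 (4 * c ^+ 2 * t ^+ 2 * I ^+ 2)).
by apply: cvgMr; exact: cvg_harmonic.
Qed.

Let icos_rho_cvg t : icos (rho k) t @[k --> \oo] --> complex.Re (cexp ((c * psi_re t) +i* (c * psi_im b t))%C).
Proof.
have E k : complex.Re (cexp (Psi k t)) = expR (c * Zre k t) * cos (c * Zim k t + t * shift k).
  by rewrite /cexp /= mul0r subr0.
have cv : complex.Re (cexp (Psi k t)) @[k --> \oo] --> complex.Re (cexp ((c * psi_re t) +i* (c * psi_im b t))%C).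
  under eq_fun do rewrite E; rewrite /cexp /= mul0r subr0.
  apply: cvgM.
    by apply: (cvg_comp _ _ (@Psi_re_cvg t)); exact: continuous_expR.
  by apply: (cvg_comp _ _ (@Psi_im_cvg t)); exact: continuous_cos.
have d0 : icos (rho k) t - complex.Re (cexp (Psi k t)) @[k --> \oo] --> (0 : R).
  apply/cvgrPdist_le => e e0; have /cvgrPdist_le/(_ _ e0) := @error_cvg t; apply: filterS => k.
  rewrite !sub0r !normrN => /(le_trans (ler_norm _)); apply: le_trans.
  by have := norm_Re_le (cf_rho_approx k t); rewrite raddfB.
have -> : (fun k => icos (rho k) t) =
    (fun k => (icos (rho k) t - complex.Re (cexp (Psi k t))) + complex.Re (cexp (Psi k t))).
  by apply/funext => k; rewrite subrK.
rewrite -[X in _ --> X]add0r; exact: cvgD d0 cv.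
Qed.

Let isin_rho_cvg t : isin (rho k) t @[k --> \oo] --> complex.Im (cexp ((c * psi_re t) +i* (c * psi_im b t))%C).
Proof.
have E k : complex.Im (cexp (Psi k t)) = expR (c * Zre k t) * sin (c * Zim k t + t * shift k).
  by rewrite /cexp /= mul0r addr0.
have cv : complex.Im (cexp (Psi k t)) @[k --> \oo] --> complex.Im (cexp ((c * psi_re t) +i* (c * psi_im b t))%C).
  under eq_fun do rewrite E; rewrite /cexp /= mul0r addr0.
  apply: cvgM.
    by apply: (cvg_comp _ _ (@Psi_re_cvg t)); exact: continuous_expR.
  by apply: (cvg_comp _ _ (@Psi_im_cvg t)); exact: continuous_sin.
have d0 : isin (rho k) t - complex.Im (cexp (Psi k t)) @[k --> \oo] --> (0 : R).
  apply/cvgrPdist_le => e e0; have /cvgrPdist_le/(_ _ e0) := @error_cvg t; apply: filterS => k.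
  rewrite !sub0r !normrN => /(le_trans (ler_norm _)); apply: le_trans.
  by have := norm_Im_le (cf_rho_approx k t); rewrite raddfB.
have -> : (fun k => isin (rho k) t) =
    (fun k => (isin (rho k) t - complex.Im (cexp (Psi k t))) + complex.Im (cexp (Psi k t))).
  by apply/funext => k; rewrite subrK.
rewrite -[X in _ --> X]add0r; exact: cvgD d0 cv.
Qed.

(** The constant is independent of [k]: its first term comes from the approximation error, where t ^
    2 <= |t|, and the others from the compensated exponent. *)
Let rho_tight k t : `|t| <= 1 ->
  1 - icos (rho k) t <= (4 * c ^+ 2 * I ^+ 2 + 4 * c * I + c * `|b|) * `|t|.
Proof.
move=> t1.
have tt : t ^+ 2 <= `|t| by rewrite -real_normK ?num_real// expr2 ler_piMl.
have I0 := levy_mass_ge0.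
have H1 : `|icos (rho k) t - complex.Re (cexp (Psi k t))| <= 4 * c ^+ 2 * I ^+ 2 * `|t|.
  have := norm_Re_le (cf_rho_approx k t); rewrite raddfB => /le_trans; apply.
  have -> : 4 * c ^+ 2 * t ^+ 2 * I ^+ 2 / k.+1%:R = 4 * c ^+ 2 * I ^+ 2 * (t ^+ 2 * k.+1%:R^-1) by ring.
  rewrite ler_wpM2l ?mulr_ge0 ?sqr_ge0//.
  by rewrite (le_trans _ tt)// ler_piMr ?sqr_ge0// invf_le1// ler1n.
have Zb1 : `|Zre k t| <= 2 * `|t| * I.
  apply: levy_Rintegral_le => [|u]; first by apply: measurable_funM => //; exact: measurable_levy_cos.
  apply: (@chi_le k (fun u => cos (t * u) - 1)); rewrite (le_trans (levy_cos_bound _ _))// ler_wpM2r ?levy_weight_ge0//; lra.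
have Zb2 : `|Rintegral nu setT (fun u => chi k u * (sin (t * u) - t * u * (`|u| <= 1)%R%:R))| <= 2 * `|t| * I.
  apply: levy_Rintegral_le => [|u]; first by apply: measurable_funM => //; exact: measurable_levy_sin.
  apply: (@chi_le k (fun u => sin (t * u) - t * u * (`|u| <= 1)%R%:R)); rewrite (le_trans (levy_sin_bound _ _))// ler_wpM2r ?levy_weight_ge0//; lra.
have Pre0 : complex.Re (Psi k t) <= 0 by exact: mulr_ge0_le0 c0 (Zre_le0 k t).
have H2 := cexp_Re_bound Pre0.
have EP : `|complex.Re (Psi k t)| + `|complex.Im (Psi k t)| = c * `|Zre k t| +
   c * `|t * b + Rintegral nu setT (fun u => chi k u * (sin (t * u) - t * u * (`|u| <= 1)%R%:R))|.
  by rewrite /= Psi_im_E (normrM c (Zre k t)) (normrM c (_ + _)) (ger0_norm c0).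
rewrite EP in H2.
set J := Rintegral _ _ _ in Zb2 H2 *.
have H3 : c * `|Zre k t| + c * `|t * b + J| <= (4 * c * I + c * `|b|) * `|t|.
  have -> : (4 * c * I + c * `|b|) * `|t| = c * (2 * `|t| * I) + c * (`|t * b| + 2 * `|t| * I).
    by rewrite normrM; ring.
  apply: lerD; first by rewrite ler_wpM2l.
  by rewrite ler_wpM2l// (le_trans (ler_normD _ _))// lerD2l.
have H4 := ler_norm (- (icos (rho k) t - complex.Re (cexp (Psi k t)))).
rewrite normrN in H4.
rewrite -[X in X * _]addrA mulrDl; apply: le_trans (lerD H1 H3).
apply: le_trans (lerD H4 H2); lra.
Qed.

Lemma cos_bdd_lip (t s : R) : bdd_lip 1 `|t| (fun x => cos (t * x + s)).
Proof.
split=> [x|x y]; first exact: cos_max.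
by rewrite (le_trans (norm_cosB _ _))// opprD addrACA subrr addr0 -mulrBr normrM.
Qed.

Lemma levy_existence : exists mu : probability (measurableTypeR R) R, forall t,
  cf mu t = cexp ((c * psi_re t) +i* (c * psi_im b t))%C.
Proof.
have [mu Hmu] := tight_limit (tightness_criterion rho_tight).
exists mu => t; apply/eqP; rewrite eq_complex; apply/andP; split; apply/eqP => /=.
  apply: (Hmu 1 `|t| (fun x => cos (t * x))); last exact: icos_rho_cvg.
  by have := cos_bdd_lip t 0; under eq_fun do rewrite addr0.
apply: (Hmu 1 `|t| (fun x => sin (t * x))); last exact: isin_rho_cvg.
by have := cos_bdd_lip t (- (pi / 2)); under eq_fun do rewrite cosBpihalf.
Qed.

End existence.

End levy_measure.

(** * The differential equation of the characteristic function *)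

Section derivation_under_integral.
Context {R : realType} d (T : measurableType d) (mu : {measure set T -> \bar R}).

(** Domination is asked only for |x| <= |a| + 1, a range containing a neighbourhood of [a], because
    the bounds for the Levy integrals grow with the frequency. *)
Lemma is_derive_Rintegral (f df : R -> T -> R) (G : T -> R) (a : R) :
  (forall x, mu.-integrable setT (EFin \o f x)) ->
  (forall (x : R) y, is_derive x 1 (f ^~ y) (df x y)) ->
  mu.-integrable setT (EFin \o G) ->
  (forall (x : R) y, `|x| <= `|a| + 1 -> `|df x y| <= G y) ->
  is_derive a 1 (fun x => Rintegral mu setT (f x)) (Rintegral mu setT (df a)).
Proof.
move=> If Df IG dfG.
have Ia : (`]a - 1, a + 1[%classic : set R) a by rewrite /= in_itv/=; apply/andP; split; lra.
have If' x : (`]a - 1, a + 1[%classic : set R) x -> mu.-integrable setT (EFin \o f x) by [].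
have Df' x y : (`]a - 1, a + 1[%classic : set R) x -> [set: T] y -> derivable (f ^~ y) x 1.
  by move=> _ _; apply: ex_derive.
have G0 y : 0 <= G y.
  apply: le_trans (normr_ge0 (df a y)) (dfG a y _).
  by rewrite lerDl.
have E x y : partial1of2 f x y = df x y by rewrite partial1of2E; apply: derive_val.
have Gub x y : (`]a - 1, a + 1[%classic : set R) x -> [set: T] y -> `|partial1of2 f x y| <= G y.
  rewrite /= in_itv/= => /andP[x1 x2] _; rewrite E; apply: dfG.
  have -> : x = a + (x - a) by ring.
  by rewrite (le_trans (ler_normD _ _))// lerD2l ler_norml; apply/andP; split; lra.
have D1 := derivable_under_integral measurableT Ia If' Df' G0 IG Gub.
have D2 := differentiation_under_integral measurableT Ia If' Df' G0 IG Gub.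
apply: DeriveDef => //; rewrite -derive1E D2.
by apply: eq_Rintegral => y _; rewrite E.
Qed.

End derivation_under_integral.

Section characteristic_function_derivative.
Context {R : realType} (mu : probability (measurableTypeR R) R).
Hypothesis mu_moment : mu.-integrable setT (EFin \o (fun x : R => `|x|)).

Definition icosx t := Rintegral mu setT (fun x => x * cos (t * x)).
Definition isinx t := Rintegral mu setT (fun x => x * sin (t * x)).

Lemma integrable_xcos t (s : R) : mu.-integrable setT (EFin \o (fun x : R => x * cos (t * x + s))).
Proof.
apply: (integrable_le _ mu_moment) => [|x].
  by apply: measurable_funM => //; exact: measurable_cos_affine.
by rewrite normrM ler_piMr// cos_max.
Qed.

Lemma is_derive_icos (t : R) : is_derive t 1 (icos mu) (- isinx t).
Proof.
have -> : - isinx t = Rintegral mu setT (fun x => - (x * sin (t * x))).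
  rewrite /isinx -mulN1r -RintegralZl//; last first.
    have := integrable_xcos t (- (pi/2)); apply: eq_integrable => // x _ /=.
    by rewrite cosBpihalf.
  by apply: eq_Rintegral => x _; rewrite mulN1r.
apply: (@is_derive_Rintegral _ _ _ mu (fun t x => cos (t * x)) (fun t x => - (x * sin (t * x))) (fun x => `|x|)).
- by move=> x; exact: integrable_cosM.
- by move=> x y; apply: is_derive_eq; rewrite /GRing.scale/=; ring.
- exact: mu_moment.
- by move=> x y _; rewrite normrN normrM ler_piMr// sin_max.
Qed.

Lemma is_derive_isin (t : R) : is_derive t 1 (isin mu) (icosx t).
Proof.
apply: (@is_derive_Rintegral _ _ _ mu (fun t x => sin (t * x)) (fun t x => x * cos (t * x)) (fun x => `|x|)).
- by move=> x; exact: integrable_sinM.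
- by move=> x y; apply: is_derive_eq; rewrite /GRing.scale/=; ring.
- exact: mu_moment.
- by move=> x y _; rewrite normrM ler_piMr// cos_max.
Qed.

End characteristic_function_derivative.

Section exponent_derivative.
Context {R : realType} (nu : {measure set (measurableTypeR R) -> \bar R}).
Hypothesis nu_levy : (\int[nu]_u (Num.min 1 ((u : R) ^+ 2))%R%:E < +oo)%E.
Hypothesis nu_first_moment :
  (\int[nu]_(u in [set u : R | (1 < `|u|)%R]) `|u : R|%R%:E < +oo)%E.
Local Notation H := levy_weight.

(** The derivative of psi is [- psi_sin + i (b + psi_cos)]. The same two integrals arise when the
    jump operator acts on a cosine, which links the identity to the equation. *)
Definition psi_cos t := Rintegral nu setT (fun u => (cos (t * u) - (`|u| <= 1)%R%:R) * u).
Definition psi_sin t := Rintegral nu setT (fun u => sin (t * u) * u).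

Lemma psi_cos_bound (t u : R) : `|(cos (t * u) - (`|u| <= 1)%R%:R) * u| <= (`|t| + 1) * H u.
Proof.
have t0 := normr_ge0 t; have u0 := normr_ge0 u.
rewrite normrM; have [u1|u1] := leP `|u| 1.
  rewrite levy_weight_small// -(real_normK (num_real u)).
  have := norm_cosB1_le (t * u); rewrite normrM; nra.
by rewrite subr0 levy_weight_big//; have := cos_max (t * u); nra.
Qed.

Lemma psi_sin_bound (t u : R) : `|sin (t * u) * u| <= (`|t| + 1) * H u.
Proof.
have t0 := normr_ge0 t; have u0 := normr_ge0 u.
rewrite normrM; have [u1|u1] := leP `|u| 1.
  rewrite levy_weight_small// -(real_normK (num_real u)).
  have := norm_sin_le (t * u); rewrite normrM; nra.
by rewrite levy_weight_big//; have := sin_max (t * u); nra.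
Qed.

Lemma measurable_psi_cos t :
  measurable_fun setT ((fun u => (cos (t * u) - (`|u| <= 1)%R%:R) * u) : measurableTypeR R -> R).
Proof.
apply: measurable_funM => //; apply: measurable_funB; first exact: measurable_cosM.
exact: measurable_norm_le1.
Qed.

Lemma measurable_psi_sin t :
  measurable_fun setT ((fun u => sin (t * u) * u) : measurableTypeR R -> R).
Proof. by apply: measurable_funM => //; exact: measurable_sinM. Qed.

Let IH K : nu.-integrable setT (EFin \o (fun u : R => K * H u)).
Proof.
by have := integrableZl measurableT K (integrable_levy_weight nu_levy nu_first_moment); apply: eq_integrable.
Qed.

Lemma is_derive_psi_re (t : R) : is_derive t 1 (psi_re nu) (- psi_sin t).
Proof.
have -> : - psi_sin t = Rintegral nu setT (fun u => - (sin (t * u) * u)).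
  rewrite /psi_sin -mulN1r -RintegralZl//.
    by apply: eq_Rintegral => u _; rewrite mulN1r.
  apply: (levy_integrable nu_levy nu_first_moment (measurable_psi_sin t)) => u.
  exact: psi_sin_bound.
apply: (@is_derive_Rintegral _ _ _ nu (fun t u => cos (t * u) - 1) (fun t u => - (sin (t * u) * u))
  (fun u => (`|t| + 1 + 1) * H u)).
- move=> x; apply: (levy_integrable nu_levy nu_first_moment (measurable_levy_cos x)) => u.
  exact: levy_cos_bound.
- by move=> x y; apply: is_derive_eq; rewrite /GRing.scale/=; ring.
- exact: IH.
- move=> x u xt; rewrite normrN (le_trans (psi_sin_bound _ _))// ler_wpM2r ?levy_weight_ge0//; lra.
Qed.

Lemma is_derive_psi_im (b t : R) : is_derive t 1 (psi_im nu b) (b + psi_cos t).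
Proof.
have D : is_derive t 1 (fun t => Rintegral nu setT (fun u => sin (t * u) - t * u * (`|u| <= 1)%R%:R)) (psi_cos t).
  apply: (@is_derive_Rintegral _ _ _ nu (fun t u => sin (t * u) - t * u * (`|u| <= 1)%R%:R)
    (fun t u => (cos (t * u) - (`|u| <= 1)%R%:R) * u) (fun u => (`|t| + 1 + 1) * H u)).
  - move=> x; apply: (levy_integrable nu_levy nu_first_moment (measurable_levy_sin x)) => u.
    exact: levy_sin_bound.
  - by move=> x y; apply: is_derive_eq; rewrite /GRing.scale/=; ring.
  - exact: IH.
  - move=> x u xt; rewrite (le_trans (psi_cos_bound _ _))// ler_wpM2r ?levy_weight_ge0//; lra.
by rewrite /psi_im; apply: is_derive_eq; rewrite /GRing.scale/=; ring.
Qed.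

Lemma psi_re0 : psi_re nu 0 = 0.
Proof.
rewrite /psi_re; under eq_Rintegral do rewrite mul0r cos0 subrr.
by rewrite Rintegral_cst// mul0r.
Qed.

Lemma psi_im0 b : psi_im nu b 0 = 0.
Proof.
rewrite /psi_im mul0r add0r; under eq_Rintegral do rewrite !mul0r sin0 subrr.
by rewrite Rintegral_cst// mul0r.
Qed.

End exponent_derivative.

(** * The equation phi' = psi' phi in real coordinates *)

Section linear_ode.
Context {R : realType}.
Variables (C S C' S' a a' beta beta' : R -> R).
Hypotheses (DC : forall t : R, is_derive t 1 C (C' t)) (DS : forall t : R, is_derive t 1 S (S' t)).
Hypotheses (Da : forall t : R, is_derive t 1 a (a' t)) (Db : forall t : R, is_derive t 1 beta (beta' t)).

(* [phi' = psi' phi] makes [exp (- psi) phi] constant. *)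
Lemma exponential_solution :
  (forall t, C' t = a' t * C t - beta' t * S t) ->
  (forall t, S' t = a' t * S t + beta' t * C t) ->
  C 0 = 1 -> S 0 = 0 -> a 0 = 0 -> beta 0 = 0 ->
  forall t, C t = expR (a t) * cos (beta t) /\ S t = expR (a t) * sin (beta t).
Proof.
move=> EC ES C0 S0 a0 b0 t.
(* [u] and [v] are the real and imaginary parts of exp (- psi) phi. *)
pose u x := expR (- a x) * (C x * cos (beta x) + S x * sin (beta x)).
pose v x := expR (- a x) * (S x * cos (beta x) - C x * sin (beta x)).
have Du (x : R) : is_derive x 1 u 0.
  apply: is_derive_eq; rewrite /GRing.scale/= EC ES; ring.
have Dv (x : R) : is_derive x 1 v 0.
  apply: is_derive_eq; rewrite /GRing.scale/= EC ES; ring.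
have u1 : u t = 1.
  by rewrite (is_derive_0_is_cst t 0 Du) /u C0 S0 a0 b0 oppr0 expR0 cos0 sin0; ring.
have v0 : v t = 0.
  by rewrite (is_derive_0_is_cst t 0 Dv) /v C0 S0 a0 b0 oppr0 expR0 cos0 sin0; ring.
have e : expR (a t) * expR (- a t) = 1 by rewrite -expRD subrr expR0.
have cs := cos2Dsin2 (beta t).
split.
  rewrite -[RHS]mulr1 -u1 /u.
  transitivity ((expR (a t) * expR (- a t)) * (C t * (cos (beta t) ^+ 2 + sin (beta t) ^+ 2))
     + expR (a t) * sin (beta t) * v t); first by rewrite e cs v0; ring.
  by rewrite /v; ring.
rewrite -[RHS]mulr1 -u1 /u.
transitivity ((expR (a t) * expR (- a t)) * (S t * (cos (beta t) ^+ 2 + sin (beta t) ^+ 2))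
   - expR (a t) * cos (beta t) * v t); first by rewrite e cs v0; ring.
by rewrite /v; ring.
Qed.

Lemma exponential_derivative :
  (forall t, C t = expR (a t) * cos (beta t)) -> (forall t, S t = expR (a t) * sin (beta t)) ->
  forall t, C' t = a' t * C t - beta' t * S t /\ S' t = a' t * S t + beta' t * C t.
Proof.
move=> EC ES t; split.
  have D : is_derive t 1 C (a' t * C t - beta' t * S t).
    have -> : C = (fun x => expR (a x) * cos (beta x)) by apply/funext.
    by apply: is_derive_eq; rewrite /GRing.scale/= ES; ring.
  by rewrite -(@derive_val _ _ _ _ _ _ _ (DC t)) (@derive_val _ _ _ _ _ _ _ D).
have D : is_derive t 1 S (a' t * S t + beta' t * C t).
  have -> : S = (fun x => expR (a x) * sin (beta x)) by apply/funext.
  by apply: is_derive_eq; rewrite /GRing.scale/= EC; ring.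
by rewrite -(@derive_val _ _ _ _ _ _ _ (DS t)) (@derive_val _ _ _ _ _ _ _ D).
Qed.

End linear_ode.

(** * The Stein operator *)

Section stein_operator.
Context {R : realType} (nu : {measure set (measurableTypeR R) -> \bar R}).
Hypothesis nu_levy : (\int[nu]_u (Num.min 1 ((u : R) ^+ 2))%R%:E < +oo)%E.
Hypothesis nu_first_moment :
  (\int[nu]_(u in [set u : R | (1 < `|u|)%R]) `|u : R|%R%:E < +oo)%E.
Variables (mu : probability (measurableTypeR R) R) (b : R).
Hypothesis mu_moment : mu.-integrable setT (EFin \o (fun x : R => `|x|)).
Local Notation H := levy_weight.
Local Notation I := (levy_mass nu).

Definition jump (f : R -> R) (x : R) : R :=
  Rintegral nu setT (fun u => (f (x + u) - f x * (`|u| <= 1)%R%:R) * u).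

Definition stein_integrand (f : R -> R) (x : R) : R := x * f x - b * f x - jump f x.

Definition stein (f : R -> R) : R := Rintegral mu setT (stein_integrand f).

Lemma bdd_lip_ge0 M L (f : R -> R) : bdd_lip M L f -> 0 <= M /\ 0 <= L.
Proof.
move=> [/(_ 0) fM /(_ 1 0)]; rewrite subr0 normr1 mulr1 => fL.
by split; [exact: le_trans fM|exact: le_trans fL].
Qed.

(** For |u| <= 1 the Lipschitz property gives L u ^ 2; for larger jumps the truncation removes [f x]
    and the bound gives M |u|. *)
Lemma jump_bound (M L : R) f (x u : R) : bdd_lip M L f ->
  `|(f (x + u) - f x * (`|u| <= 1)%R%:R) * u| <= (L + M) * H u.
Proof.
move=> fML; have [M0 L0] := bdd_lip_ge0 fML; have [fM fL] := fML.
have u0 := normr_ge0 u.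
rewrite normrM; have [u1|u1] := leP `|u| 1.
  rewrite mulr1 levy_weight_small// -(real_normK (num_real u)).
  have := fL (x + u) x; rewrite (_ : x + u - x = u); last by ring.
  have := normr_ge0 (f (x + u) - f x); nra.
rewrite mulr0 subr0 levy_weight_big//.
have := fM (x + u); have := normr_ge0 (f (x + u)); nra.
Qed.

Lemma measurable_jump M L f x : bdd_lip M L f -> measurable_fun setT
  ((fun u => (f (x + u) - f x * (`|u| <= 1)%R%:R) * u) : measurableTypeR R -> R).
Proof.
move=> fML; apply: measurable_funM => //; apply: measurable_funB.
  apply: (measurableT_comp (bdd_lip_measurable fML)).
  by apply: measurable_funD.
by apply: measurable_funM => //; exact: measurable_norm_le1.
Qed.

Lemma jump_integrable M L f x : bdd_lip M L f -> nu.-integrable setT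
  (EFin \o (fun u : R => (f (x + u) - f x * (`|u| <= 1)%R%:R) * u)).
Proof.
move=> fML.
apply: (levy_integrable (C := L + M) nu_levy nu_first_moment (measurable_jump x fML)) => u.
exact: jump_bound.
Qed.

Let IH K : nu.-integrable setT (EFin \o (fun u : R => K * H u)).
Proof.
by have := integrableZl measurableT K (integrable_levy_weight nu_levy nu_first_moment); apply: eq_integrable.
Qed.

Lemma norm_jump M L f x : bdd_lip M L f -> `|jump f x| <= (L + M) * I.
Proof.
move=> fML; apply: (levy_Rintegral_le nu_levy nu_first_moment (measurable_jump x fML)) => u.
exact: jump_bound.
Qed.

(** Continuity provides the measurability in [x] needed to integrate the jump term against the
    law. *)
Lemma continuous_jump M L f : bdd_lip M L f -> continuous (jump f).
Proof.
move=> fML x; apply/(@cvg_nbhsP _ R^o) => w wx.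
have cf := bdd_lip_continuous fML.
apply: (@Rintegral_dominated_cvg _ _ _ nu
  (fun n u => (f (w n + u) - f (w n) * (`|u| <= 1)%R%:R) * u) _ (fun u => (L + M) * H u)).
- by move=> n; exact: measurable_jump fML.
- exact: IH.
- by move=> n u; exact: jump_bound.
- move=> u; apply: cvgMl; apply: cvgB.
    have wu : w n + u @[n --> \oo] --> x + u by apply: cvgD => //; exact: cvg_cst.
    exact: (cvg_comp _ _ wu (cf (x + u))).
  by apply: cvgMl; exact: (cvg_comp _ _ wx (cf x)).
Qed.

Lemma measurable_stein_integrand M L f : bdd_lip M L f ->
  measurable_fun setT (stein_integrand f : measurableTypeR R -> R).
Proof.
move=> fML; have mf := bdd_lip_measurable fML.
apply: measurable_funB; last by apply: continuous_measurable_fun; exact: continuous_jump fML.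
by apply: measurable_funB; exact: measurable_funM.
Qed.

Let dominant M L : R -> R := fun x => M * `|x| + (`|b| * M + (L + M) * I).

Let dominant_integrable M L : mu.-integrable setT (EFin \o dominant M L).
Proof.
have I1 := integrableZl measurableT M mu_moment.
have I2 := finite_measure_integrable_cst mu (`|b| * M + (L + M) * I) measurableT.
by have := integrableD measurableT I1 I2; apply: eq_integrable.
Qed.

Let stein_integrand_bound M L f x : bdd_lip M L f -> `|stein_integrand f x| <= dominant M L x.
Proof.
move=> fML; have [fM _] := fML.
rewrite /stein_integrand /dominant addrA (le_trans (ler_normB _ _))// lerD//; last exact: norm_jump.
rewrite (le_trans (ler_normB _ _))// !normrM lerD//; last by rewrite ler_wpM2l.
by rewrite mulrC ler_wpM2r.
Qed.

Lemma stein_integrable M L f : bdd_lip M L f -> mu.-integrable setT (EFin \o stein_integrand f).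
Proof.
move=> fML; apply: (integrable_le (measurable_stein_integrand fML) (dominant_integrable M L)) => x.
exact: stein_integrand_bound.
Qed.

Lemma jumpD M L M' L' f g x : bdd_lip M L f -> bdd_lip M' L' g ->
  jump (fun y => f y + g y) x = jump f x + jump g x.
Proof.
move=> fML gML; rewrite /jump -RintegralD//; [|exact: jump_integrable fML|exact: jump_integrable gML].
by apply: eq_Rintegral => u _; ring.
Qed.

Lemma jumpZ M L f x a : bdd_lip M L f -> jump (fun y => a * f y) x = a * jump f x.
Proof.
move=> fML; rewrite /jump -RintegralZl//; last exact: jump_integrable fML.
by apply: eq_Rintegral => u _; ring.
Qed.

Lemma steinD M L M' L' f g : bdd_lip M L f -> bdd_lip M' L' g ->
  stein (fun y => f y + g y) = stein f + stein g.
Proof.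
move=> fML gML; rewrite /stein -RintegralD//; [|exact: stein_integrable fML|exact: stein_integrable gML].
by apply: eq_Rintegral => x _; rewrite /stein_integrand (jumpD x fML gML); ring.
Qed.

Lemma steinZ M L f a : bdd_lip M L f -> stein (fun y => a * f y) = a * stein f.
Proof.
move=> fML; rewrite /stein -RintegralZl//; last exact: stein_integrable fML.
by apply: eq_Rintegral => x _; rewrite /stein_integrand (jumpZ x a fML); ring.
Qed.

(** Two nested dominated convergences, against nu inside and the law outside; both dominating
    functions depend on the approximants only through [M] and [L]. *)
Lemma stein_cvg M L (f_ : nat -> R -> R) f : (forall n, bdd_lip M L (f_ n)) -> bdd_lip M L f ->
  (forall x, f_ ^~ x @ \oo --> f x) -> stein (f_ n) @[n --> \oo] --> stein f.
Proof.
move=> f_ML fML f_f.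
apply: (@Rintegral_dominated_cvg _ _ _ mu (fun n => stein_integrand (f_ n)) _ (dominant M L)).
- by move=> n; exact: measurable_stein_integrand (f_ML n).
- exact: dominant_integrable.
- by move=> n x; exact: stein_integrand_bound.
- move=> x; apply: cvgB; first by apply: cvgB; apply: cvgMr; exact: f_f.
  apply: (@Rintegral_dominated_cvg _ _ _ nu
    (fun n u => (f_ n (x + u) - f_ n x * (`|u| <= 1)%R%:R) * u) _ (fun u => (L + M) * H u)).
  + by move=> n; exact: measurable_jump (f_ML n).
  + exact: IH.
  + by move=> n u; exact: jump_bound (f_ML n).
  + move=> u; apply: cvgMl; apply: cvgB; first exact: f_f.
    by apply: cvgMl; exact: f_f.
Qed.

Lemma jump_cos t s x : jump (fun y => cos (t * y + s)) x =
  cos (t * x + s) * psi_cos nu t - sin (t * x + s) * psi_sin nu t.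
Proof.
have I1 : nu.-integrable setT (EFin \o (fun u => (cos (t * u) - (`|u| <= 1)%R%:R) * u)).
  apply: (levy_integrable nu_levy nu_first_moment (measurable_psi_cos t)) => u.
  exact: psi_cos_bound.
have I2 : nu.-integrable setT (EFin \o (fun u => sin (t * u) * u)).
  apply: (levy_integrable nu_levy nu_first_moment (measurable_psi_sin t)) => u.
  exact: psi_sin_bound.
rewrite /psi_cos /psi_sin -!RintegralZl// -RintegralB//.
- apply: eq_Rintegral => u _.
  have -> : t * (x + u) + s = (t * x + s) + t * u by ring.
  by rewrite cosD; ring.
- by have := integrableZl measurableT (cos (t * x + s)) I1; apply: eq_integrable.
- by have := integrableZl measurableT (sin (t * x + s)) I2; apply: eq_integrable.
Qed.

(** The coefficients of [cos s] and [sin s] are the imaginary and real parts of phi' - psi' phi at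
    [t]. *)
Lemma stein_cos (t s : R) : stein (fun y => cos (t * y + s)) =
  cos s * (icosx mu t - (b + psi_cos nu t) * icos mu t + psi_sin nu t * isin mu t) +
  sin s * (- isinx mu t + (b + psi_cos nu t) * isin mu t + psi_sin nu t * icos mu t).
Proof.
set A := psi_cos nu t; set B := psi_sin nu t.
have Ixc : mu.-integrable setT (EFin \o (fun x : R => x * cos (t * x))).
  by have := integrable_xcos mu_moment t 0; apply: eq_integrable => // x _ /=; rewrite addr0.
have Ixs : mu.-integrable setT (EFin \o (fun x : R => x * sin (t * x))).
  have := integrable_xcos mu_moment t (- (pi/2)); apply: eq_integrable => // x _ /=.
  by rewrite cosBpihalf.
have Ic := integrable_cosM mu t.
have Is := integrable_sinM mu t.
pose p1 := cos s; pose p2 := - sin s.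
pose p3 := - (b + A) * cos s + B * sin s; pose p4 := (b + A) * sin s + B * cos s.
have scale (g : R -> R) a : mu.-integrable setT (EFin \o g) -> mu.-integrable setT (EFin \o (fun x : R => a * g x)).
  by move=> Ig; have := integrableZl measurableT a Ig; apply: eq_integrable.
have add (g h : R -> R) : mu.-integrable setT (EFin \o g) -> mu.-integrable setT (EFin \o h) ->
    mu.-integrable setT (EFin \o (fun x : R => g x + h x)).
  by move=> Ig Ih; have := integrableD measurableT Ig Ih; apply: eq_integrable.
have J1 := scale _ p1 Ixc; have J2 := scale _ p2 Ixs.
have J3 := scale _ p3 Ic; have J4 := scale _ p4 Is.
transitivity (Rintegral mu setT (fun x => (p1 * (x * cos (t * x)) + p2 * (x * sin (t * x))) +
   (p3 * cos (t * x) + p4 * sin (t * x)))).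
  apply: eq_Rintegral => x _; rewrite /stein_integrand jump_cos -/A -/B cosD sinD /p1 /p2 /p3 /p4.
  ring.
rewrite RintegralD//; [|exact: add|exact: add].
rewrite RintegralD// RintegralD// !RintegralZl//.
by rewrite -/(icosx mu t) -/(isinx mu t) -/(icos mu t) -/(isin mu t) /p1 /p2 /p3 /p4; ring.
Qed.

Lemma trig_bdd_lip (f : R -> R) : trig f -> exists M L, bdd_lip M L f.
Proof.
elim=> {f} [a t s|f g _ [M [L [fM fL]]] _ [M' [L' [gM gL]]]].
  exists (`|a| * 1), (`|a| * `|t|); have [cM cL] := cos_bdd_lip t s.
  split=> [x|x y]; first by rewrite normrM ler_wpM2l.
  by rewrite -mulrBr normrM -mulrA ler_wpM2l.
exists (M + M'), (L + L'); split=> [x|x y]; first by rewrite (le_trans (ler_normD _ _))// lerD.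
by rewrite opprD addrACA mulrDl (le_trans (ler_normD _ _))// lerD.
Qed.

Lemma stein_eq0 : (forall t s, stein (fun y => cos (t * y + s)) = 0) ->
  forall M L f, bdd_lip M L f -> stein f = 0.
Proof.
move=> H0.
have trig0 f : trig f -> stein f = 0.
  elim=> {f} [a t s|f g tf f0 tg g0]; first by rewrite (steinZ a (cos_bdd_lip t s)) H0 mulr0.
  have [M [L fML]] := trig_bdd_lip tf; have [M' [L' gML]] := trig_bdd_lip tg.
  by rewrite (steinD fML gML) f0 g0 addr0.
move=> M L f fML; have [f_ [f_trig f_ML f_f]] := trig_approx fML.
have := stein_cvg f_ML fML f_f.
under eq_fun do rewrite trig0//.
by move=> /(cvg_unique _ (cvg_cst 0))<-.
Qed.

End stein_operator.

(** * Test functions, characteristic functions and exponents in the form of the statement *)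

Section statement_bridge.
Context {R : realType}.

Lemma bdd_lip_of (f : R -> R) : bounded_fun f -> lipschitz f -> exists M L, bdd_lip M L f.
Proof.
(* Both properties hold for all constants strictly above a threshold, hence the added 1. *)
move=> [M [_ fM]] [L [_ fL]]; exists (M + 1), (L + 1); split=> [x|x y].
  by apply: (fM (M + 1)); rewrite ?ltrDl.
by have := fL (L + 1); rewrite ltrDl ltr01 => /(_ isT (x, y)); apply.
Qed.

Lemma bounded_lipschitz_cos (t s : R) :
  bounded_fun (fun x : R => cos (t * x + s)) /\ lipschitz (fun x : R => cos (t * x + s)).
Proof.
have [cM cL] := cos_bdd_lip t s; split.
  by exists 1; split=> // M M1 x _ /=; rewrite (le_trans (cM x))// ltW.
exists `|t|; split=> [|L tL [x y] _ /=]; first exact: num_real.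
by rewrite (le_trans (cL x y))// ler_wpM2r// ltW.
Qed.

Local Open Scope complex_scope.

Lemma Re_cexp_i (y : R) : complex.Re (cexp ('i * y%:C)) = cos y.
Proof. by rewrite /cexp /= !(mul0r, mul1r, mulr0, subr0, add0r, addr0, sub0r, oppr0) expR0 mul1r. Qed.

Lemma Im_cexp_i (y : R) : complex.Im (cexp ('i * y%:C)) = sin y.
Proof. by rewrite /cexp /= !(mul0r, mul1r, mulr0, subr0, add0r, addr0, sub0r, oppr0) expR0 mul1r. Qed.

Lemma levy_exponentE (b : R) (nu : {measure set (measurableTypeR R) -> \bar R}) t :
  levy_exponent b nu t = psi_re nu t +i* psi_im nu b t.
Proof.
rewrite /levy_exponent /Cintegral /psi_re /psi_im.
pose simp := (mul0r, mul1r, mulr0, subr0, add0r, addr0, sub0r, oppr0).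
apply/eqP; rewrite eq_complex; apply/andP; split; apply/eqP; rewrite /= !simp.
  by apply: eq_Rintegral => u _; rewrite /= !simp expR0 mul1r.
by congr (_ + _); apply: eq_Rintegral => u _; rewrite /= !simp expR0 mul1r.
Qed.

Lemma char_funE d (T : measurableType d) (P : probability T R) (X : {RV P >-> measurableTypeR R}) t :
  char_fun X t = cf (distribution P X) t.
Proof.
have mX : measurable_fun setT (X : T -> measurableTypeR R) by [].
rewrite /char_fun /Cintegral /cf /icos /isin; congr (_ +i* _).
  rewrite /Rintegral (@integral_distribution _ _ _ _ _ P X (EFin \o (fun x : R => cos (t * x)))).
  - by congr fine; apply: eq_integral => w _; rewrite Re_cexp_i.
  - by apply/measurable_EFinP; exact: measurable_cosM.
  - apply: (@integrable_bounded _ _ _ P (fun w => cos (t * X w)) 1) => [|w]; last exact: cos_max.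
    by apply: (measurableT_comp (measurable_cosM t)).
rewrite /Rintegral (@integral_distribution _ _ _ _ _ P X (EFin \o (fun x : R => sin (t * x)))).
- by congr fine; apply: eq_integral => w _; rewrite Im_cexp_i.
- by apply/measurable_EFinP; exact: measurable_sinM.
- apply: (@integrable_bounded _ _ _ P (fun w => sin (t * X w)) 1) => [|w]; last exact: sin_max.
  by apply: (measurableT_comp (measurable_sinM t)).
Qed.

End statement_bridge.

Theorem theorem3p1 (R : realType) (d : measure_display) (T : measurableType d)
    (P : probability T R) (X : {RV P >-> measurableTypeR R})
    (X_integrable : ('E_P[(fun w => `|X w|)%R] < +oo)%E)
    (b : R) (nu : {measure set (measurableTypeR R) -> \bar R})
    (nu_0 : nu [set 0] = 0%E)
    (nu_levy : (\int[nu]_u (Num.min 1 ((u : R) ^+ 2))%R%:E < +oo)%E)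
    (nu_first_moment :
       (\int[nu]_(u in [set u : R | (1 < `|u|)%R]) `|u : R|%R%:E < +oo)%E) :
  (forall f : R -> R, bounded_fun f -> lipschitz f ->
     ('E_P[(fun w => X w * f (X w) - b * f (X w)
        - \int[nu]_u ((f (X w + u) - f (X w) * (`|u : R| <= 1)%R%:R) * u))%R]
      = 0)%E)
  <-> has_law_ID X b nu.
Proof.
pose mu : probability (measurableTypeR R) R := distribution P X.
have mX : measurable_fun setT (X : T -> measurableTypeR R) by [].
have IX : P.-integrable setT (EFin \o (fun w => `|X w|)).
  apply/integrableP; split; first by apply/measurable_EFinP; exact: measurableT_comp.
  move: X_integrable; rewrite unlock => /(le_lt_trans _); apply.
  by rewrite le_eqVlt; apply/orP; left; apply/eqP; apply: eq_integral => w _ /=; rewrite normr_id.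
have mu_moment : mu.-integrable setT (EFin \o (fun x : R => `|x|)).
  by apply: integrable_pushforward => //; apply/measurable_EFinP; exact: measurableT_comp.
(* Change of variables to the law of [X]; integrability of the Stein integrand makes the extended
   expectation equal to a finite real integral. *)
have steinE f M L : bdd_lip M L f -> ('E_P[(fun w => X w * f (X w) - b * f (X w)
        - \int[nu]_u ((f (X w + u) - f (X w) * (`|u : R| <= 1)%R%:R) * u))%R] = (stein nu mu b f)%:E)%E.
  move=> fML; have IS := stein_integrable nu_levy nu_first_moment b mu_moment fML.
  have mS := measurable_stein_integrand nu_levy nu_first_moment b fML.
  rewrite unlock /stein /Rintegral fineK; last exact: integrable_fin_num.
  rewrite (@integral_distribution _ _ _ _ _ P X (EFin \o stein_integrand nu b f))//.
    exact/measurable_EFinP.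
  have mS' : measurable_fun setT (EFin \o stein_integrand nu b f : measurableTypeR R -> \bar R).
    exact/measurable_EFinP.
  apply/integrableP; split; first exact: (measurableT_comp mS').
  rewrite -(@ge0_integral_distribution _ _ _ _ _ P X (fun x => `|(EFin \o stein_integrand nu b f) x|%E))//.
    by have /integrableP[] := IS.
  exact: measurableT_comp.
have DC t := is_derive_icos mu_moment t.
have DS t := is_derive_isin mu_moment t.
have Da t := is_derive_psi_re nu_levy nu_first_moment t.
have Db t := is_derive_psi_im nu_levy nu_first_moment b t.
split=> [H|[_ Hcf]].
  have H0 t s : stein nu mu b (fun y => cos (t * y + s)) = 0.
    have [h1 h2] := bounded_lipschitz_cos t s.
    by apply: EFin_inj; exact: etrans (esym (steinE _ _ _ (cos_bdd_lip t s))) (H _ h1 h2).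
  (* At the phase - pi / 2 only the coefficient of [sin s] survives, the real part of the equation;
     the phase 0 gives the imaginary part. *)
  have HC t : - isinx mu t = - psi_sin nu t * icos mu t - (b + psi_cos nu t) * isin mu t.
    have := H0 t (- (pi / 2)); rewrite stein_cos// cosN sinN cos_pihalf sin_pihalf; lra.
  have HS t : icosx mu t = - psi_sin nu t * isin mu t + (b + psi_cos nu t) * icos mu t.
    have := H0 t 0; rewrite stein_cos// cos0 sin0; lra.
  have i0 : icos mu 0 = 1.
    rewrite /icos; under eq_Rintegral do rewrite mul0r cos0.
    by rewrite Rintegral_cst//= probability_setT mulr1.
  have s0 : isin mu 0 = 0.
    rewrite /isin; under eq_Rintegral do rewrite mul0r sin0.
    by rewrite Rintegral_cst// mul0r.
  have sol := exponential_solution DC DS Da Db HC HS i0 s0 (psi_re0 nu) (psi_im0 nu b).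
  have cfE t : cf mu t = cexp (psi_re nu t +i* psi_im nu b t)%C.
    have [Ct St] := sol t.
    by apply/eqP; rewrite eq_complex /= mul0r mul0r subr0 addr0 Ct St !eqxx.
  split=> [n n0|t]; last by rewrite char_funE levy_exponentE -cfE.
  (* The law with exponent psi / n is an n-th convolution root: the n-th power of its characteristic
     function is exp psi, and uniqueness turns this into equality of measures. *)
  have ninv : 0 <= n%:R^-1 :> R by rewrite invr_ge0.
  have [rho rhoE] := levy_existence nu_levy nu_first_moment b ninv.
  exists rho.
  have cfrho t : cf mu t = cf (convolution_power rho n) t.
    rewrite cf_convolution_power rhoE -cexpMn cfE; congr cexp.
    have E (x y : R) k : (x +i* y)%C *+ k = ((x *+ k) +i* (y *+ k))%C.
      by elim: k => [|k IH]; rewrite ?mulr0n// !mulrS IH.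
    by rewrite E -!(mulr_natl (_ * _)) !mulVKf// pnatr_eq0 -lt0n.
  by apply: cf_uniqueness => t; have [] := cfrho t.
have cfE t : cf mu t = cexp (psi_re nu t +i* psi_im nu b t)%C.
  by rewrite -levy_exponentE -Hcf char_funE.
have HC t : icos mu t = expR (psi_re nu t) * cos (psi_im nu b t).
  by have [-> _] := cfE t; rewrite mul0r subr0.
have HS t : isin mu t = expR (psi_re nu t) * sin (psi_im nu b t).
  by have [_ ->] := cfE t; rewrite mul0r addr0.
have ode := exponential_derivative DC DS Da Db HC HS.
(* The equation makes both coefficients in [stein_cos] vanish, so the identity holds on cosines of
   every phase and extends by approximation. *)
move=> f fb fl; have [M [L fML]] := bdd_lip_of fb fl.
rewrite (steinE _ _ _ fML); congr EFin.
apply: (stein_eq0 nu_levy nu_first_moment mu_moment _ fML) => t s.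
rewrite stein_cos//.
have [E1 E2] := ode t; rewrite E1 E2; ring.
Qed.
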